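(* Let $G$ be a closed group of Weyl-transitive, type-preserving automorphisms of a thick, locally finite building $(\Delta,\delta)$ and let $g\in G$. Then the stabilizer of a simplex $a$ is tidy for $g$ if and only if $\delta(a,g.a)$ is $\operatorname{cotype}(a)$-straight.
   Context: $\Delta$ is a building of type $(W,S)$, $S$ finite, $\ell$ the length function; for $J\subseteq S$, $W_J=\langle J\rangle$. Simplices are spherical residues; the simplex with residue $R_J(x)=\{y:\delta(x,y)\in W_J\}$ ($W_J$ finite) has cotype $J$. For simplices $a,b$ with residues $\mathcal{A},\mathcal{B}$, $\delta(a,b)$ is the unique minimal length element of $\{\delta(x,y):x\in\mathcal{A},y\in\mathcal{B}\}$. Type-preserving means preserving $\delta$; Weyl-transitive means any two pairs of chambers with equal Weyl distance are mapped to each other by an element of $G$. $G$ has the compact-open topology; a compact open subgroup $U$ is tidy for $g$ if it minimizes $|gUg^{-1}:gUg^{-1}\cap U|$. For spherical $I\subseteq S$, $w\in W$ is $I$-straight if $w$ is of minimal length in $W_IwW_I$, $wIw^{-1}=I$, and $\ell(w^n)=n\,\ell(w)$ for all $n\in\mathbb{N}$. *)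

(* Defs.v *)
From Stdlib Require Import List Arith.
Import ListNotations.

Definition is_group (T : Type) (mul : T -> T -> T) (one : T) (inv : T -> T) : Prop :=
  (forall a b c, mul a (mul b c) = mul (mul a b) c) /\
  (forall a, mul one a = a) /\ (forall a, mul a one = a) /\
  (forall a, mul (inv a) a = one) /\ (forall a, mul a (inv a) = one).

Fixpoint gpow (T : Type) (mul : T -> T -> T) (one : T) (x : T) (n : nat) : T :=
  match n with O => one | S k => mul x (gpow T mul one x k) end.

Fixpoint wprod (T : Type) (mul : T -> T -> T) (one : T) (l : list T) : T :=
  match l with nil => one | a :: l' => mul a (wprod T mul one l') end.

Section Coxeter.
Variables (W : Type) (mul : W -> W -> W) (one : W) (inv : W -> W) (S : list W).

Definition in_S (s : W) : Prop := In s S.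

Definition in_WJ (J : W -> Prop) (w : W) : Prop :=
  exists l, Forall J l /\ wprod W mul one l = w.

Definition has_length (w : W) (n : nat) : Prop :=
  (exists l, Forall in_S l /\ length l = n /\ wprod W mul one l = w) /\
  (forall l, Forall in_S l -> wprod W mul one l = w -> n <= length l).

(* (W,S) is a Coxeter system: W is a group generated by the finite set S of
   involutions, and W has the presentation <S | (st)^{m_st} = 1>, where
   m_st is the order of st (expressed through the universal property). *)
Definition is_coxeter_system : Prop :=
  is_group W mul one inv /\
  (forall w, in_WJ in_S w) /\
  (forall s, in_S s -> s <> one /\ mul s s = one) /\
  (forall (H : Type) (hmul : H -> H -> H) (hone : H) (hinv : H -> H),
     is_group H hmul hone hinv ->
     forall f : W -> H,
       (forall s t n, in_S s -> in_S t -> gpow W mul one (mul s t) n = one ->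
          gpow H hmul hone (hmul (f s) (f t)) n = hone) ->
       exists phi : W -> H,
         (forall a b, phi (mul a b) = hmul (phi a) (phi b)) /\
         (forall s, in_S s -> phi s = f s)).

Definition spherical (J : W -> Prop) : Prop :=
  (forall s, J s -> in_S s) /\ exists l : list W, forall w, in_WJ J w -> In w l.

Definition straight (I : W -> Prop) (w : W) : Prop :=
  (forall u v, in_WJ I u -> in_WJ I v ->
     forall n m, has_length w n -> has_length (mul (mul u w) v) m -> n <= m) /\
  (forall s, I s -> I (mul (mul w s) (inv w))) /\
  (forall t, I t -> exists s, I s /\ mul (mul w s) (inv w) = t) /\
  (forall k n, has_length w n -> has_length (gpow W mul one w k) (k * n)).

Section Building.
Variables (C : Type) (delta : C -> C -> W).

(* W-metric building of type (W,S) (Abramenko--Brown, Def. 5.1) *)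
Definition is_building : Prop :=
  (forall x y, delta x y = one <-> x = y) /\
  (forall x y z w s, delta x y = w -> in_S s -> delta y z = s ->
     (delta x z = mul w s \/ delta x z = w) /\
     (forall n, has_length w n -> has_length (mul w s) (Datatypes.S n) ->
        delta x z = mul w s)) /\
  (forall x y s, in_S s -> exists z, delta y z = s /\ delta x z = mul (delta x y) s).

Definition thick : Prop :=
  forall x s, in_S s -> exists y z, delta x y = s /\ delta x z = s /\ y <> z.

Definition locally_finite : Prop :=
  forall x s, in_S s -> exists l : list C, forall y, delta x y = s -> In y l.

Definition residue (J : W -> Prop) (x : C) (y : C) : Prop := in_WJ J (delta x y).

Definition res_dist (A B : C -> Prop) (w : W) : Prop :=
  (exists y z, A y /\ B z /\ delta y z = w) /\
  (forall y z, A y -> B z -> delta y z <> w ->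
     forall n m, has_length w n -> has_length (delta y z) m -> n < m).

Definition tp_aut (f : C -> C) : Prop :=
  (forall x y, f x = f y -> x = y) /\ (forall z, exists x, f x = z) /\
  (forall x y, delta (f x) (f y) = delta x y).

Variable G : (C -> C) -> Prop.

Definition aut_group : Prop :=
  (forall f, G f -> tp_aut f) /\ G (fun x => x) /\
  (forall f h, G f -> G h -> G (fun x => f (h x))) /\
  (forall f, G f -> exists h, G h /\ forall x, h (f x) = x /\ f (h x) = x).

(* G is closed in Aut(Delta) for the compact-open (= pointwise) topology *)
Definition closed_group : Prop :=
  forall f, tp_aut f ->
    (forall F : list C, exists h, G h /\ forall x, In x F -> h x = f x) -> G f.

Definition weyl_transitive : Prop :=
  forall x y x' y', delta x y = delta x' y' ->
    exists g, G g /\ g x = x' /\ g y = y'.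

Definition open_in_G (O : (C -> C) -> Prop) : Prop :=
  (forall f, O f -> G f) /\
  forall f, O f -> exists F : list C,
    forall h, G h -> (forall x, In x F -> h x = f x) -> O h.

Definition compact_in_G (U : (C -> C) -> Prop) : Prop :=
  (forall f, U f -> G f) /\
  forall (I : Type) (O : I -> (C -> C) -> Prop),
    (forall i, open_in_G (O i)) -> (forall f, U f -> exists i, O i f) ->
    exists l : list I, forall f, U f -> exists i, In i l /\ O i f.

Definition subgroup_of_G (U : (C -> C) -> Prop) : Prop :=
  (forall f, U f -> G f) /\ U (fun x => x) /\
  (forall f h, U f -> U h -> U (fun x => f (h x))) /\
  (forall f, U f -> exists h, U h /\ forall x, h (f x) = x /\ f (h x) = x).

Definition compact_open_subgroup (U : (C -> C) -> Prop) : Prop :=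
  subgroup_of_G U /\ open_in_G U /\ compact_in_G U.

Definition conj_sub (U : (C -> C) -> Prop) (g : C -> C) (v : C -> C) : Prop :=
  exists u, U u /\ forall x, v (g x) = g (u x).

Definition in_lcoset (H : (C -> C) -> Prop) (r v : C -> C) : Prop :=
  exists h, H h /\ forall x, v x = r (h x).

Definition index_is (K H : (C -> C) -> Prop) (n : nat) : Prop :=
  exists reps : list (C -> C),
    length reps = n /\ (forall r, In r reps -> K r) /\
    (forall v, K v -> exists r, In r reps /\ in_lcoset H r v) /\
    (forall i j, i < n -> j < n ->
       in_lcoset H (nth i reps (fun x => x)) (nth j reps (fun x => x)) -> i = j).

Definition disp_index (U : (C -> C) -> Prop) (g : C -> C) (n : nat) : Prop :=
  index_is (conj_sub U g) (fun h => conj_sub U g h /\ U h) n.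

Definition tidy (U : (C -> C) -> Prop) (g : C -> C) : Prop :=
  compact_open_subgroup U /\
  exists n, disp_index U g n /\
    forall V m, compact_open_subgroup V -> disp_index V g m -> n <= m.

(* stabilizer in G of the simplex with residue A *)
Definition stabilizer (A : C -> Prop) (f : C -> C) : Prop :=
  G f /\ (forall y, A y -> A (f y)) /\ (forall z, A z -> exists y, A y /\ f y = z).

Definition image_res (g : C -> C) (A : C -> Prop) (z : C) : Prop :=
  exists y, A y /\ g y = z.

End Building.
End Coxeter.

(* Main.v *)
(* Write a_i = g^i a and let q_v be the number of chambers at Weyl distance v from a given chamber.
   If w = delta(a, g a) is J-straight, the indices of g^n U g^-n are q_w^n; since any two compact open
   subgroups are commensurable, no V can have a displacement index m < q_w, as q_w^n <= K m^n for all n.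
   Conversely let U = G_a be tidy, of index d.  Iterating the projection of a onto g a followed by g^-1
   shrinks a to a residue R such that R and gR are parallel, at distance some w' in W_J w W_J; the index of
   G_R is at most q_w', so d <= q_w', and counting the chambers at distance in W_J w W_J from a chamber of
   g a in two ways forces W_J w W_J = w' W_J, hence w' = w and w J w^-1 = J.  Finally the index of
   G_a0 /\ .../\ G_an is at least d, so this group is transitive on the residues b with
   delta(b, a_0) = w, and delta(b, a_n) does not depend on b; in a thick building this fails as soon as
   l(w^(n+1)) < l(w) + l(w^n), because then some gallery from a_n to b can be folded. *)

(* Indices are handled as numbers of left cosets that suffice for a covering: these multiply along
   chains of subgroups, and Weyl-transitivity turns them into counts of chambers. Counting starts at
   chambers of the residue of [g a] and looks back towards [a], which is why [inv w] appears where
   one might expect [w]. The shrinking of the residue stops because its type decreases strictly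
   inside the finite set [S] until the projection is a parallelism. The transitivity in the last
   step has this source. If [V] stabilizes every member of X = {a, ..., g^m a}, then gX together
   with [a] contains X, so gVg^-1 meets [V] and the stabilizer [U] of [a] in the same group. By
   minimality gVg^-1 has at least d cosets modulo that group, while the stabilizer of [g a] is
   covered by d cosets of [U]; so gVg^-1 meets all of them. Folding deletes a letter from a reduced
   word of w^-1, and transitivity would place the shorter product in w^-1 W_J, whose shortest
   element is w^-1. [W] is given only by its universal property. Deletion of letters is extracted
   from it first, and the length facts on cosets follow by cutting subwords into pieces. *)
Require Import Defs.
From Stdlib Require Import List Arith Lia.
From Stdlib Require Import Classical ClassicalEpsilon FunctionalExtensionality.
From Stdlib Require Import PropExtensionality ssreflect.
Import ListNotations.
Set SsrOldRewriteGoalsOrder.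

(** * Finite lists *)

Definition decide (P : Prop) : bool :=
  match excluded_middle_informative P with left _ => true | right _ => false end.

Lemma decideP (P : Prop) : decide P = true <-> P.
Proof. by rewrite /decide; case: excluded_middle_informative. Qed.

Lemma ex_least (P : nat -> Prop) :
  (exists n, P n) -> exists n, P n /\ forall m, P m -> n <= m.
Proof.
  case=> n; elim/lt_wf_ind: n => n IH Pn.
  case: (classic (exists m, P m /\ m < n)) => [[m [Pm lt]] | no]; first exact: IH Pm.
  exists n; split=> // m Pm.
  case: (le_lt_dec n m) => // lt; case: no; by exists m.
Qed.

Lemma pigeonhole (X Y : Type) (R : X -> Y -> Prop) (l : list X) (L : list Y) :
  NoDup l ->
  (forall x, In x l -> exists y, In y L /\ R x y) ->
  (forall x x' y, In x l -> In x' l -> R x y -> R x' y -> x = x') ->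
  length l <= length L.
Proof.
  elim: l L => [|x l IH] L nd tot inj /=; first lia.
  have [y [yL Rxy]] := tot x (or_introl eq_refl).
  have [L1 [L2 eL]] := in_split _ _ yL.
  inversion nd as [|? ? xl nd']; subst.
  have : length l <= length (L1 ++ L2).
  { apply: IH => // [z zl | z z' y0 zl z'l]; last by apply: inj; right.
    have [y' [y'L Rzy']] := tot z (or_intror zl).
    exists y'; split=> //.
    move: y'L; rewrite !in_app_iff /= => -[|[e|]]; auto.
    subst y'; case: xl.
    by rewrite (inj x z y) //; [left | right]. }
  rewrite !length_app /=; lia.
Qed.

Lemma NoDup_flat_map (X Y : Type) (f : X -> list Y) (l : list X) :
  NoDup l -> (forall x, In x l -> NoDup (f x)) ->
  (forall x x' y, In x l -> In x' l -> In y (f x) -> In y (f x') -> x = x') ->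
  NoDup (flat_map f l).
Proof.
  elim: l => [|x l IH] nd ndf inj /=; first by constructor.
  inversion nd as [|? ? xl nd']; subst.
  apply: NoDup_app.
  - by apply: ndf; left.
  - apply: IH => // [z zl | z z' y zl z'l]; first by apply: ndf; right.
    by apply: inj; right.
  - move=> y yx /in_flat_map [z [zl yz]].
    case: xl; rewrite (inj x z y) //; [by left | by right].
Qed.

Lemma length_flat_map_const (X Y : Type) (f : X -> list Y) (l : list X) (n : nat) :
  (forall x, In x l -> length (f x) = n) -> length (flat_map f l) = length l * n.
Proof.
  elim: l => [|x l IH] //= h.
  rewrite length_app h ?IH; auto.
Qed.

Lemma finite_NoDup (X : Type) (P : X -> Prop) (l : list X) :
  (forall x, P x -> In x l) -> exists l', NoDup l' /\ forall x, In x l' <-> P x.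
Proof.
  move=> h.
  have dec : forall x y : X, {x = y} + {x <> y} by move=> x y; exact: excluded_middle_informative.
  exists (nodup dec (filter (fun x => decide (P x)) l)); split; first exact: NoDup_nodup.
  move=> x; rewrite nodup_In filter_In decideP.
  split=> [[] // | Px]; auto.
Qed.

Lemma finite_injective_surjective (X : Type) (P : X -> Prop) (l : list X) (f : X -> X) :
  (forall x, P x -> In x l) -> (forall x, P x -> P (f x)) ->
  (forall x y, P x -> P y -> f x = f y -> x = y) ->
  forall y, P y -> exists x, P x /\ f x = y.
Proof.
  move=> fin stab inj y Py.
  have [l' [nd eP]] := finite_NoDup X P l fin.
  have : incl l' (map f l').
  { apply: NoDup_length_incl.
    - apply: NoDup_map_NoDup_ForallPairs => // x x' xl x'l; apply: inj; exact/eP.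
    - by rewrite length_map.
    - by move=> _ /in_map_iff [x [<- /eP Px]]; apply/eP; auto. }
  move=> /(_ y) h.
  have /in_map_iff [x [e /eP Px]] := h (proj2 (eP y) Py).
  by exists x.
Qed.

(** * Subwords and parity sums *)

Inductive subword (T : Type) : list T -> list T -> Prop :=
| subword_nil : subword T nil nil
| subword_skip x l l' : subword T l l' -> subword T l (x :: l')
| subword_keep x l l' : subword T l l' -> subword T (x :: l) (x :: l').
Arguments subword {T}.

Lemma subword_refl T (l : list T) : subword l l.
Proof. by elim: l => [|x l IH]; constructor. Qed.

Lemma subword_length T (l l' : list T) : subword l l' -> length l <= length l'.
Proof. by elim=> //= *; lia. Qed.

Lemma subword_full T (l l' : list T) : subword l l' -> length l' <= length l -> l = l'.
Proof.
  elim=> //= [x {}l {}l' h IH le | x {}l {}l' h IH le].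
  - have := subword_length _ _ _ h; lia.
  - by have := subword_length _ _ _ h; rewrite IH //; lia.
Qed.

Lemma subword_app T (a a' b b' : list T) :
  subword a a' -> subword b b' -> subword (a ++ b) (a' ++ b').
Proof. by elim=> //= *; constructor; auto. Qed.

Lemma subword_app_inv T (l a b : list T) :
  subword l (a ++ b) -> exists l1 l2, l = l1 ++ l2 /\ subword l1 a /\ subword l2 b.
Proof.
  elim: a l => [|x a IH] l /= h.
  - by exists nil, l; split=> //; split=> //; constructor.
  - inversion h as [|? ? ? h'|? ? ? h']; subst.
    + have [l1 [l2 [-> [h1 h2]]]] := IH _ h'.
      exists l1, l2; split=> //; split=> //; by constructor.
    + have [l1 [l2 [-> [h1 h2]]]] := IH _ h'.
      exists (x :: l1), l2; split=> //; split=> //; by constructor.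
Qed.

Lemma subword_Forall T (P : T -> Prop) (l l' : list T) :
  subword l l' -> Forall P l' -> Forall P l.
Proof.
  elim=> // x {}l {}l' _ IH H; inversion H; subst; first exact: IH.
  constructor=> //; exact: IH.
Qed.

Lemma subword_trans T (a b c : list T) : subword b c -> subword a b -> subword a c.
Proof.
  move=> h; elim: h a => // [x l l' _ IH a h | x l l' _ IH a h].
  - constructor; exact: IH.
  - inversion h; subst; constructor; exact: IH.
Qed.

Fixpoint xor_sum (f : nat -> bool) (n : nat) : bool :=
  match n with O => false | S k => xorb (f 0) (xor_sum (fun i => f (S i)) k) end.

Lemma xor_sum_ext f h n : (forall i, i < n -> f i = h i) -> xor_sum f n = xor_sum h n.
Proof.
  elim: n f h => [|n IH] f h e //=.
  rewrite e; last lia. rewrite (IH _ (fun i => h (S i))) // => i lt; apply: e; lia.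
Qed.

Lemma xor_sum_add f n m : xor_sum f (n + m) = xorb (xor_sum f n) (xor_sum (fun i => f (n + i)) m).
Proof.
  elim: n f => [|n IH] f /=; first by case: xor_sum.
  by rewrite IH Bool.xorb_assoc.
Qed.

Lemma xor_sum_pairs f n :
  xor_sum (fun i => xorb (f (2 * i)) (f (2 * i + 1))) n = xor_sum f (2 * n).
Proof.
  elim: n f => [|n IH] f //.
  have -> : 2 * S n = S (S (2 * n)) by lia.
  rewrite /= -(IH (fun i => f (S (S i)))) Bool.xorb_assoc.
  congr xorb; congr xorb; apply: xor_sum_ext => i _.
  by congr xorb; f_equal; lia.
Qed.

(** * Coxeter groups *)

Section Coxeter.
Variables (W : Type) (mul : W -> W -> W) (one : W) (inv : W -> W) (S : list W).
Hypothesis HC : is_coxeter_system W mul one inv S.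

Local Infix "**" := mul (at level 40, left associativity).
Local Notation prod := (wprod W mul one).
Local Notation inW := (in_WJ W mul one).
Local Notation isS := (in_S W S).
Local Notation pow := (gpow W mul one).

Lemma mulA a b c : a ** (b ** c) = a ** b ** c. Proof. exact: (proj1 (proj1 HC)). Qed.
Lemma mul1w a : one ** a = a. Proof. exact: (proj1 (proj2 (proj1 HC))). Qed.
Lemma mulw1 a : a ** one = a. Proof. exact: (proj1 (proj2 (proj2 (proj1 HC)))). Qed.
Lemma mulVw a : inv a ** a = one. Proof. exact: (proj1 (proj2 (proj2 (proj2 (proj1 HC))))). Qed.
Lemma mulwV a : a ** inv a = one. Proof. exact: (proj2 (proj2 (proj2 (proj2 (proj1 HC))))). Qed.
Lemma mulK a b : a ** b ** inv b = a. Proof. by rewrite -mulA mulwV mulw1. Qed.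
Lemma mulVK a b : a ** inv b ** b = a. Proof. by rewrite -mulA mulVw mulw1. Qed.
Lemma mulI a b c : c ** a = c ** b -> a = b.
Proof. by move=> e; rewrite -(mul1w a) -(mul1w b) -(mulVw c) -!mulA e. Qed.
Lemma mulIr a b c : a ** c = b ** c -> a = b.
Proof. by move=> e; rewrite -(mulK a c) e mulK. Qed.
Lemma inv_unique a b : a ** b = one -> inv a = b.
Proof. by move=> e; apply: (mulI _ _ a); rewrite e mulwV. Qed.
Lemma invK a : inv (inv a) = a. Proof. exact/inv_unique/mulVw. Qed.
Lemma invM a b : inv (a ** b) = inv b ** inv a.
Proof. by apply: inv_unique; rewrite mulA mulK mulwV. Qed.
Lemma inv1 : inv one = one. Proof. exact/inv_unique/mulw1. Qed.
Lemma SS s : isS s -> s ** s = one.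
Proof. by move=> h; case: (proj1 (proj2 (proj2 HC)) s h). Qed.
Lemma S_neq1 s : isS s -> s <> one.
Proof. by move=> h; case: (proj1 (proj2 (proj2 HC)) s h). Qed.
Lemma invS s : isS s -> inv s = s. Proof. by move=> h; exact/inv_unique/SS. Qed.
Lemma mulSK a s : isS s -> a ** s ** s = a.
Proof. by move=> h; rewrite -mulA SS ?mulw1. Qed.
Lemma mulKS a s : isS s -> s ** (s ** a) = a.
Proof. by move=> h; rewrite mulA SS ?mul1w. Qed.

Lemma prod_app a b : prod (a ++ b) = prod a ** prod b.
Proof. by elim: a => [|x a IH] /=; rewrite ?mul1w // IH mulA. Qed.

Lemma prod_rev l : Forall isS l -> prod (rev l) = inv (prod l).
Proof.
  elim=> [|s {}l hs hl IH] /=; first by rewrite inv1.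
  by rewrite prod_app /= mulw1 IH invM (invS s).
Qed.

Lemma inW_one J : inW J one. Proof. by exists nil. Qed.
Lemma inW_mul J a b : inW J a -> inW J b -> inW J (a ** b).
Proof.
  move=> [l [hl <-]] [m [hm <-]]; exists (l ++ m); split; last exact: prod_app.
  exact/Forall_app.
Qed.
Lemma inW_gen (J : W -> Prop) s : J s -> inW J s.
Proof. by move=> h; exists [s]; split; [constructor | rewrite /= mulw1]. Qed.
Lemma inW_sub (J K : W -> Prop) a : (forall s, J s -> K s) -> inW J a -> inW K a.
Proof. by move=> h [l [hl <-]]; exists l; split=> //; apply: Forall_impl hl. Qed.
Lemma inW_all w : inW isS w. Proof. exact: (proj1 (proj2 HC)). Qed.
Lemma inW_inv (J : W -> Prop) a : (forall s, J s -> isS s) -> inW J a -> inW J (inv a).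
Proof.
  move=> JS [l [hl <-]]; exists (rev l); split; first exact: Forall_rev.
  by rewrite prod_rev //; apply: Forall_impl hl.
Qed.

(** * Word length *)

Lemma length_exists w : exists n, has_length W mul one S w n.
Proof.
  have [l0 [hl0 e0]] := inW_all w.
  have [n [[l hl] least]] :=
    ex_least (fun n => exists l, Forall isS l /\ length l = n /\ prod l = w)
      (ex_intro _ _ (ex_intro _ l0 (conj hl0 (conj eq_refl e0)))).
  exists n; split; first by exists l.
  by move=> l' hl' e'; apply: least; exists l'.
Qed.

Lemma has_length_unique w n m :
  has_length W mul one S w n -> has_length W mul one S w m -> n = m.
Proof.
  move=> [[l [hl [<- el]]] hn] [[k [hk [<- ek]]] hm].
  have := hn k hk ek; have := hm l hl el; lia.
Qed.

Definition len (w : W) : nat := proj1_sig (constructive_indefinite_description _ (length_exists w)).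

Lemma lenP w : has_length W mul one S w (len w).
Proof. exact: (proj2_sig (constructive_indefinite_description _ (length_exists w))). Qed.

Lemma has_lengthE w n : has_length W mul one S w n <-> n = len w.
Proof.
  split=> [h | ->]; last exact: lenP.
  exact: has_length_unique h (lenP w).
Qed.

Lemma len_prod l : Forall isS l -> len (prod l) <= length l.
Proof. by move=> h; apply: (proj2 (lenP (prod l))). Qed.

Lemma reduced_word w : exists l, Forall isS l /\ length l = len w /\ prod l = w.
Proof. exact: (proj1 (lenP w)). Qed.

Lemma len_one : len one = 0.
Proof. have := len_prod nil (Forall_nil _) => /=; lia. Qed.

Lemma len_eq0 w : len w = 0 -> w = one.
Proof. by move=> e; have [l [_ [h <-]]] := reduced_word w; rewrite e in h; case: l h. Qed.

Lemma len_mul a b : len (a ** b) <= len a + len b.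
Proof.
  have [l [hl [<- <-]]] := reduced_word a; have [m [hm [<- <-]]] := reduced_word b.
  rewrite -prod_app -length_app; apply: len_prod; exact/Forall_app.
Qed.

Lemma len_inv_le a : len (inv a) <= len a.
Proof.
  have [l [hl [<- e]]] := reduced_word a.
  rewrite -e -prod_rev // -length_rev; apply: len_prod; exact: Forall_rev.
Qed.

Lemma len_inv a : len (inv a) = len a.
Proof. have := len_inv_le a; have := len_inv_le (inv a); rewrite invK; lia. Qed.

Lemma len_S_le s : isS s -> len s <= 1.
Proof. by move=> h; have := len_prod [s] (Forall_cons _ h (Forall_nil _)); rewrite /= mulw1. Qed.

Lemma len_S s : isS s -> len s = 1.
Proof.
  move=> h; have := len_S_le s h.
  have : len s <> 0 by move=> e; exact: (S_neq1 s h (len_eq0 s e)).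
  lia.
Qed.

Lemma len_mulS_ge a s : isS s -> len a <= len (a ** s) + 1.
Proof. by move=> h; have := len_mul (a ** s) s; rewrite mulSK // (len_S s). Qed.

(* The semidirect product of the group of functions W -> Z/2 by W (acting by
   conjugation): sending s to (s, indicator of s) respects the Coxeter relations
   and yields the cocycle counting, mod 2, the occurrences of a reflection among
   the reflections attached to a word. *)
Local Notation H := (W * (W -> bool))%type.
Local Notation xmul := (fun p q : H =>
  (fst p ** fst q, fun t => xorb (snd q t) (snd p (fst q ** t ** inv (fst q))))).
Local Notation xone := (one, fun _ : W => false).
Local Notation xinv := (fun p : H => (inv (fst p), fun t => snd p (inv (fst p) ** t ** fst p))).

Lemma semidirect_group : is_group H xmul xone xinv.
Proof.
  split; [|split; [|split; [|split]]] => /=.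
  - move=> [a f] [b h] [c k] /=; rewrite mulA; congr pair.
    apply: functional_extensionality => t; rewrite -Bool.xorb_assoc invM !mulA //.
  - move=> [a f] /=; rewrite mul1w; congr pair.
    by apply: functional_extensionality => t; case: (f t).
  - move=> [a f] /=; rewrite mulw1; congr pair.
    by apply: functional_extensionality => t; rewrite inv1 mul1w mulw1; case: (f t).
  - move=> [a f] /=; rewrite mulVw; congr pair.
    apply: functional_extensionality => t.
    by rewrite !mulA mulVw mul1w mulVK; case: (f t).
  - move=> [a f] /=; rewrite mulwV; congr pair.
    apply: functional_extensionality => t.
    by rewrite invK; case: (f _).
Qed.

Lemma pow_S_r x n : pow x n ** x = x ** pow x n.
Proof. by elim: n => [|n IH] /=; rewrite ?mul1w ?mulw1 // -mulA IH. Qed.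

Lemma pow_add x n m : pow x (n + m) = pow x n ** pow x m.
Proof. by elim: n => [|n IH] /=; rewrite ?mul1w // IH mulA. Qed.

Lemma pow_inv x n : pow (inv x) n = inv (pow x n).
Proof. by elim: n => [|n IH] /=; rewrite ?inv1 // IH -pow_S_r invM. Qed.

Lemma semidirect_pow (x : W) (f : W -> bool) n :
  gpow H xmul xone (x, f) n =
  (pow x n, fun t => xor_sum (fun i => f (pow x i ** t ** inv (pow x i))) n).
Proof.
  elim: n => [|n IH] //=; rewrite IH /=; congr pair.
  apply: functional_extensionality => t.
  have := xor_sum_add (fun i => f (pow x i ** t ** inv (pow x i))) n 1.
  by rewrite Nat.add_1_r /= Nat.add_0_r Bool.xorb_false_r => <-.
Qed.

Definition eqw (a b : W) : bool := decide (a = b).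

Lemma eqwP a b : eqw a b = true <-> a = b. Proof. exact: decideP. Qed.

Lemma eqw_iff a b c d : (a = b <-> c = d) -> eqw a b = eqw c d.
Proof. by move=> h; apply: Bool.eq_true_iff_eq; rewrite !eqwP. Qed.

(** Evaluated at [r], the second component is the parity of the number of j < 2n with [r = rf j],
    where [rf j = (ts)^j t]: even indices come from the letter [t], odd ones from [s]. Since (ts)^n
    = 1, [rf] has period n, so every reflection is met an even number of times. *)
Lemma semidirect_relations s t n : isS s -> isS t -> pow (s ** t) n = one ->
  gpow H xmul xone (xmul (s, fun r => eqw r s) (t, fun r => eqw r t)) n = xone.
Proof.
  move=> hs ht e.
  rewrite /= semidirect_pow e; congr pair.
  apply: functional_extensionality => r.
  pose rf j := pow (t ** s) j ** t.
  pose f j := eqw r (rf j).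
  rewrite (xor_sum_ext _ (fun i => xorb (f (2 * i)) (f (2 * i + 1)))); last first.
  - move=> i _.
    have conj : forall u, rf (2 * i + u) = inv (pow (s ** t) i) ** rf u ** pow (s ** t) i.
    { move=> u; rewrite /rf.
      have -> : 2 * i + u = i + (u + i) by lia.
      rewrite !pow_add -!pow_inv invM (invS s) // (invS t) // -!mulA; congr (_ ** (_ ** _)).
      elim: i {e} => [|i IH] /=; first by rewrite mul1w mulw1.
      by rewrite -mulA IH !mulA. }
    have solve : forall p q c, (inv c ** q ** c = p) <-> (c ** p ** inv c = q).
    { move=> p q c; split=> <-; rewrite !mulA ?mulwV ?mulVw ?mul1w ?mulK ?mulVK //. }
    congr xorb; apply: eqw_iff.
    + have -> : 2 * i = 2 * i + 0 by lia.
      rewrite conj /rf /= mul1w; split=> h; first by rewrite -(proj2 (solve _ _ _) h).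
      by apply/solve; rewrite h.
    + rewrite conj /rf /= mulw1.
      have := solve r s (t ** pow (s ** t) i).
      rewrite invM (invS t) // !mulA => h; split=> e'; [by symmetry; apply/h | by apply/h].
  - rewrite xor_sum_pairs.
  have -> : 2 * n = n + n by lia.
  rewrite xor_sum_add (xor_sum_ext (fun i => f (n + i)) f); first by case: xor_sum.
  move=> i _; apply: eqw_iff; rewrite /rf pow_add.
  have -> : pow (t ** s) n = one; last by rewrite mul1w.
  by rewrite -(invK (t ** s)) pow_inv invM (invS s) // (invS t) // e inv1.
Qed.

(** The homomorphism into the semidirect product is the identity in its first component, because it
    fixes the generators; its second component is therefore a cocycle [eta] on [W], independent of
    the choice of words. *)
Lemma reflection_cocycle : exists eta : W -> W -> bool,
  (forall a b t, eta (a ** b) t = xorb (eta b t) (eta a (b ** t ** inv b))) /\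
  (forall s t, isS s -> eta s t = eqw t s).
Proof.
  have [phi [hmul hgen]] := proj2 (proj2 (proj2 HC)) H xmul xone xinv semidirect_group
    (fun s => (s, fun r => eqw r s)) semidirect_relations.
  have phi1 : phi one = xone.
  { have := hmul one one; rewrite mul1w; case: (phi one) => [a f] /= [ea ef].
    have {}ea : a = one by apply: (mulI _ _ a); rewrite -ea mulw1.
    subst a; congr pair; apply: functional_extensionality => t.
    move: (equal_f ef t); rewrite inv1 mul1w mulw1; by case: (f t). }
  have fstphi : forall a, fst (phi a) = a.
  { move=> a; have [l [hl <-]] := inW_all a.
    elim: hl => [|s {}l hs hl IH] /=; first by rewrite phi1.
    by rewrite hmul /= IH (hgen s hs). }
  exists (fun a => snd (phi a)); split.
  - by move=> a b t; rewrite hmul /= !fstphi.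
  - by move=> s t hs; rewrite (hgen s hs).
Qed.

Lemma exchange l s : Forall isS l -> isS s ->
  (len (prod l) < len (prod l ** s) \/
   exists l1 t l2, l = l1 ++ t :: l2 /\ prod l ** s = prod (l1 ++ l2)).
Proof.
  have [eta [hmul hgen]] := reflection_cocycle.
  have eta1 : forall t, eta one t = false.
  { move=> t; have := hmul one one t; rewrite mul1w inv1 mul1w mulw1; by case: (eta one t). }
  (* An odd count means that [t] is the reflection attached to some letter of [l]; multiplying by
     [t] cancels exactly this letter. *)
  have del : forall l t, Forall isS l -> eta (prod l) t = true ->
    exists l1 s l2, l = l1 ++ s :: l2 /\ prod l ** t = prod (l1 ++ l2).
  { move=> {}l t; elim=> [|x {}l hx hl IH] /=; first by rewrite eta1.
    rewrite hmul (hgen x) //.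
    case e : (eta (prod l) t); rewrite ?Bool.xorb_false_l.
    - move=> _; have [l1 [y [l2 [-> e2]]]] := IH e.
      exists (x :: l1), y, l2; split=> //=; by rewrite -mulA e2.
    - move=> /eqwP ex; exists nil, x, l; split=> //=.
      by rewrite -mulA -[prod l ** t](mulVK _ (prod l)) ex mulKS. }
  move=> hl hs; case e : (eta (prod l) s); first by right; exact: del.
  left.
  (* Here [eta] at [s] turns from false to true on passing to [prod l ** s], so a reduced word of
     that product loses a letter when multiplied by [s]. *)
  have [m [hm [em epm]]] := reduced_word (prod l ** s).
  have : eta (prod m) s = true.
  { rewrite epm hmul (hgen s) // (invS s) // SS // mul1w e Bool.xorb_false_r. by apply/eqwP. }
  move=> /(del _ _ hm) [m1 [t [m2 [em' ep]]]].
  rewrite -em em' -[X in len X](mulSK _ s hs) -epm ep.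
  have hm' : Forall isS (m1 ++ m2).
  { move: hm; rewrite em' => /Forall_app [h1 h2]; inversion h2; exact/Forall_app. }
  have := len_prod _ hm'; rewrite !length_app /=; lia.
Qed.

(** The deletion condition in a form that keeps track of which letters survive; it is the source of
    the length formulas for parabolic cosets below. *)
Lemma reduced_subword l : Forall isS l ->
  exists l', subword l' l /\ prod l' = prod l /\ length l' = len (prod l).
Proof.
  elim/rev_ind: l => [|s l IH] h.
  - exists nil; rewrite /= len_one; by split=> //; constructor.
  - move/Forall_app: h => [hl hs]; inversion hs as [|? ? hs' _]; subst.
    have [l' [sub [e elen]]] := IH hl.
    have hl' := subword_Forall _ _ _ _ sub hl.
    rewrite prod_app /= mulw1.
    case: (exchange l' s hl' hs'); rewrite e.
    + move=> lt; exists (l' ++ [s]); split; first exact/subword_app/subword_refl.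
      split; first by rewrite prod_app /= mulw1 e.
      rewrite length_app /= elen.
      have := len_mul (prod l) s; rewrite (len_S s) //; lia.
    + move=> [l1 [t [l2 [el' ep]]]]; exists (l1 ++ l2); split; last split=> //.
      * rewrite -[X in subword X _]app_nil_r; apply: subword_app; last by repeat constructor.
        apply: (subword_trans _ _ _ _ sub); rewrite el'.
        apply: subword_app; first exact: subword_refl.
        constructor; exact: subword_refl.
      * have hl'' : Forall isS (l1 ++ l2).
        { move: hl'; rewrite el' => /Forall_app [h1 h2]; inversion h2; exact/Forall_app. }
        have := len_prod _ hl''; have := len_mulS_ge (prod l) s hs'.
        move: elen; rewrite el' ep !length_app /=; lia.
Qed.


(** * Shortest representatives of parabolic cosets and double cosets *)

Definition min_right (J : W -> Prop) (p : W) : Prop :=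
  forall v, inW J v -> len p <= len (p ** v).

Definition min_double (J : W -> Prop) (p : W) : Prop :=
  forall u v, inW J u -> inW J v -> len p <= len (u ** p ** v).

Section Parabolic.
Variable J : W -> Prop.
Hypothesis JS : forall s, J s -> isS s.

Lemma parabolic_reduced_word v :
  inW J v -> exists l, Forall J l /\ length l = len v /\ prod l = v.
Proof.
  move=> [l [hl <-]].
  have hl' : Forall isS l by apply: Forall_impl hl.
  have [l' [sub [e elen]]] := reduced_subword l hl'.
  exists l'; split=> //; exact: subword_Forall sub hl.
Qed.

(** A reduced word in letters of [J] has one letter here. This is how conjugates of generators are
    later recognised as generators. *)
Lemma parabolic_len1 v : inW J v -> len v = 1 -> J v.
Proof.
  move=> /parabolic_reduced_word [l [hl [<-]]].
  case: l hl => [|s [|? ?]] //= hl <- _; rewrite mulw1; by inversion hl.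
Qed.

(** Reduce the concatenated words of [u], [w], [v] to a subword. Its middle piece still represents
    an element of the double coset, so minimality of [w] forbids deleting any letter there; [u'] and
    [v'] are what survives on the two sides. *)
Lemma double_coset_normal_form w u v : min_double J w -> inW J u -> inW J v ->
  exists u' v', inW J u' /\ inW J v' /\ u ** w ** v = u' ** w ** v' /\
    len (u ** w ** v) = len u' + len w + len v'.
Proof.
  move=> hw [lu [hlu <-]] [lv [hlv <-]].
  have [lw [hlw [elw ew]]] := reduced_word w.
  have hl : Forall isS (lu ++ lw ++ lv).
  { apply/Forall_app; split; first by apply: Forall_impl hlu.
    apply/Forall_app; split=> //; by apply: Forall_impl hlv. }
  have [l' [sub [e elen]]] := reduced_subword _ hl.
  move: e elen; rewrite !prod_app ew mulA.
  have [lu' [r [-> [subu subr]]]] := subword_app_inv _ _ _ _ sub.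
  have [lw' [lv' [-> [subw subv]]]] := subword_app_inv _ _ _ _ subr.
  have hlu' := subword_Forall _ _ _ _ subu hlu.
  have hlv' := subword_Forall _ _ _ _ subv hlv.
  have hlw' := subword_Forall _ _ _ _ subw hlw.
  rewrite !prod_app !length_app mulA => e elen.
  have Wu : inW J (prod lu) by exists lu.
  have Wv : inW J (prod lv) by exists lv.
  have Wu' : inW J (prod lu') by exists lu'.
  have Wv' : inW J (prod lv') by exists lv'.
  have ew' : lw' = lw.
  { apply: subword_full subw _; rewrite elw.
    apply: (Nat.le_trans _ _ _ _ (len_prod _ hlw')).
    have -> : prod lw' = (inv (prod lu') ** prod lu) ** w ** (prod lv ** inv (prod lv')).
    { rewrite !mulA -(mulA (inv _)) -(mulA (inv _) _ (prod lv)) -e !mulA mulVw mul1w mulK //. }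
    apply: hw; apply: inW_mul => //; exact: inW_inv. }
  subst lw'; exists (prod lu'), (prod lv'); split=> //; split=> //.
  rewrite ew in e; split=> //.
  have h1 := len_prod lu' (Forall_impl _ JS hlu').
  have h2 := len_prod lv' (Forall_impl _ JS hlv').
  have h3 := len_mul (prod lu' ** w) (prod lv').
  have h4 := len_mul (prod lu') w.
  rewrite e in h3; lia.
Qed.

Lemma min_right_len p v : min_right J p -> inW J v -> len (p ** v) = len p + len v.
Proof.
  move=> hp hv.
  have [lv [hlv [elv ev]]] := parabolic_reduced_word v hv.
  have [lp [hlp [elp ep]]] := reduced_word p.
  have hl : Forall isS (lp ++ lv).
  { apply/Forall_app; split=> //; by apply: Forall_impl hlv. }
  have [l' [sub [e elen]]] := reduced_subword _ hl.
  move: e elen; rewrite !prod_app ep ev.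
  have [lp' [lv' [-> [subp subv]]]] := subword_app_inv _ _ _ _ sub.
  have hlv' := subword_Forall _ _ _ _ subv hlv.
  have hlp' := subword_Forall _ _ _ _ subp hlp.
  rewrite !prod_app !length_app => e elen.
  have elp' : lp' = lp.
  { apply: subword_full subp _; rewrite elp.
    apply: (Nat.le_trans _ _ _ _ (len_prod _ hlp')).
    have -> : prod lp' = p ** (v ** inv (prod lv')) by rewrite mulA -e mulK.
    apply: hp; apply: inW_mul => //; apply: inW_inv => //; by exists lv'. }
  subst lp'; rewrite ep in e; have {}e := mulI _ _ _ e.
  have := len_prod lv' (Forall_impl _ JS hlv'); rewrite e.
  have := len_mul p v; lia.
Qed.

Lemma min_right_exists p : exists v, inW J v /\ min_right J (p ** v).
Proof.
  have [n [[v [hv en]] least]] := ex_least (fun n => exists v, inW J v /\ len (p ** v) = n)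
    (ex_intro _ _ (ex_intro _ one (conj (inW_one J) eq_refl))).
  exists v; split=> // v' hv'; rewrite en -mulA; apply: least.
  exists (v ** v'); split=> //; exact: inW_mul.
Qed.

(** Write [p] as its shortest coset representative times an element of W_J; the last letter of a
    reduced word of that element can be stripped off. *)
Lemma not_min_right p : ~ min_right J p -> exists t, J t /\ len (p ** t) < len p.
Proof.
  move=> hp.
  have [v [hv hq]] := min_right_exists p.
  have hv' := inW_inv J v JS hv.
  have [l [hl [el ev]]] := parabolic_reduced_word _ hv'.
  have ep : p = p ** v ** inv v by rewrite mulK.
  elim/rev_ind: l hl el ev => [|t l _] hl el /= ev.
  - by case: hp; rewrite ep -ev mulw1.
  - move/Forall_app: hl => [{}hl /(Forall_inv (P := J)) ht].
    exists t; split=> //.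
    have e : inv v ** t = prod l.
    { by rewrite -ev prod_app /= mulw1 (mulSK _ t) //; apply: JS. }
    have Wl : inW J (prod l) by exists l.
    have := len_prod l (Forall_impl _ JS hl).
    have h1 : len p = len (p ** v) + len (inv v) by rewrite -(min_right_len _ _ hq hv') mulK.
    have h2 : len (p ** t) = len (p ** v) + len (prod l).
    { by rewrite -(min_right_len _ _ hq Wl) -e mulA mulK. }
    move: el; rewrite h1 h2 length_app /=; lia.
Qed.

Lemma min_right_unique p v : min_right J p -> inW J v -> min_right J (p ** v) -> v = one.
Proof.
  move=> hp hv /(_ _ (inW_inv _ _ JS hv)); rewrite mulK (min_right_len _ _ hp hv) => h.
  apply: len_eq0; lia.
Qed.

Lemma min_double_right w : min_double J w -> min_right J w.
Proof. by move=> h v hv; have := h one v (inW_one J) hv; rewrite mul1w. Qed.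

Lemma min_double_inv w : min_double J w -> min_double J (inv w).
Proof.
  move=> h u v hu hv; have := h (inv v) (inv u) (inW_inv _ _ JS hv) (inW_inv _ _ JS hu).
  by rewrite -(len_inv w) -(len_inv (u ** _ ** _)) !invM invK mulA.
Qed.

Lemma min_right_in_double w u v : min_double J w -> inW J u -> inW J v ->
  min_right J (u ** w ** v) -> exists u', inW J u' /\ u ** w ** v = u' ** w.
Proof.
  move=> hw hu hv.
  have [u' [v' [hu' [hv' [-> elen]]]]] := double_coset_normal_form w u v hw hu hv.
  move=> /(_ _ (inW_inv _ _ JS hv')); rewrite mulK elen.
  have := len_mul u' w => h1 h2.
  have -> : v' = one by apply: len_eq0; lia.
  by exists u'; rewrite mulw1.
Qed.

(** Some [t] in [J] shortens [s ** p] but lengthens [p]. By exchange [t] deletes a letter of the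
    word [s :: l]; a letter of [l] would make [p ** t] shorter than [p], so the deleted letter is
    [s]. *)
Lemma deodhar p s : min_right J p -> isS s -> ~ min_right J (s ** p) ->
  exists t, J t /\ s ** p = p ** t.
Proof.
  move=> hp hs /not_min_right [t [ht lt]]; exists t; split=> //.
  have hpt := min_right_len p t hp (inW_gen J t ht).
  rewrite (len_S t (JS t ht)) in hpt.
  have [l [hl [el el']]] := reduced_word p.
  have hsp : len (p ** t) <= len (s ** p ** t) + 1.
  { have := len_mul s (s ** p ** t); rewrite -mulA mulKS // (len_S s hs) mulA; lia. }
  have : len (s ** p) = len p + 1.
  { have := len_mul s p; rewrite (len_S s hs); lia. }
  move=> hsp1.
  case: (exchange (s :: l) t (Forall_cons _ hs hl) (JS t ht)); rewrite /= el'; first lia.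
  move=> [[|x l1] [y [l2 [/= eq]]]]; injection eq => e0 e1.
  - by rewrite -e0 el' => h; rewrite -(mulSK (s ** p) t) ?h //; apply: JS.
  - rewrite -e1 -mulA => /mulI e2.
    have e := e0.
    have : len (p ** t) <= length (l1 ++ l2).
    { rewrite e2; apply: len_prod; move: hl; rewrite e => /Forall_app [h1 h2].
      apply/Forall_app; split=> //; by inversion h2. }
    move: el; rewrite e !length_app /=; lia.
Qed.

End Parabolic.


(** * Buildings *)

Section Building.
Variables (C : Type) (delta : C -> C -> W).
Hypothesis HD : is_building W mul one S C delta.

Lemma delta_eq x y : delta x y = one <-> x = y. Proof. by case: HD => h _; exact: h. Qed.
Lemma delta_refl x : delta x x = one. Proof. by apply/delta_eq. Qed.

Lemma delta_step x y z s : isS s -> delta y z = s ->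
  delta x z = delta x y ** s \/ delta x z = delta x y.
Proof. by move=> hs e; case: (proj1 (proj2 HD) x y z _ s eq_refl hs e). Qed.

Lemma delta_step_up x y z s : isS s -> delta y z = s ->
  len (delta x y) < len (delta x y ** s) -> delta x z = delta x y ** s.
Proof.
  move=> hs e lt; have [_ h] := proj1 (proj2 HD) x y z _ s eq_refl hs e.
  apply: (h (len (delta x y))); apply/has_lengthE => //.
  have := len_mul (delta x y) s; rewrite (len_S s hs); lia.
Qed.

Lemma delta_ext x y s : isS s -> exists z, delta y z = s /\ delta x z = delta x y ** s.
Proof. exact: (proj2 (proj2 HD)). Qed.

Lemma delta_symS x y s : isS s -> delta x y = s -> delta y x = s.
Proof.
  move=> hs e; have [z [e1 e2]] := delta_ext x y s hs.
  move: e2; rewrite e SS // => /delta_eq e2; by subst z.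
Qed.

Fixpoint gallery (x : C) (l : list W) (y : C) : Prop :=
  match l with
  | nil => x = y
  | s :: l' => exists z, delta x z = s /\ gallery z l' y
  end.

Lemma gallery_app x a b z : gallery x (a ++ b) z <-> exists y, gallery x a y /\ gallery y b z.
Proof.
  elim: a x => [|s a IH] x /=.
  - split=> [h | [y [-> //]]]; by exists x.
  - split.
    + move=> [x' [e /IH [y [h1 h2]]]]; exists y; split=> //; by exists x'.
    + move=> [y [[x' [e h1]] h2]]; exists x'; split=> //; apply/IH; by exists y.
Qed.

Lemma gallery_rev x l y : Forall isS l -> gallery x l y -> gallery y (rev l) x.
Proof.
  elim: l x => [|s l IH] x hl /=; first by [].
  inversion hl; subst => -[z [e h]].
  apply/gallery_app; exists z; split; first exact: IH.
  exists x; split=> //; exact: delta_symS.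
Qed.

Lemma gallery_delta x y l z : Forall isS l -> gallery y l z ->
  len (delta x y ** prod l) = len (delta x y) + length l ->
  delta x z = delta x y ** prod l.
Proof.
  elim: l y => [|s l IH] y hl /=; first by move=> ->; rewrite mulw1.
  inversion hl as [|? ? hs hl']; subst => -[y' [e h]].
  rewrite mulA => elen.
  have h1 := len_mul (delta x y ** s) (prod l).
  have h2 := len_prod l hl'.
  have h3 := len_mul (delta x y) s; rewrite (len_S s hs) in h3.
  have e' : delta x y' = delta x y ** s by apply: delta_step_up => //; lia.
  rewrite -e'; apply: IH => //; rewrite e'; lia.
Qed.

Lemma gallery_back x z w l : Forall isS l -> delta x z = w ** prod l ->
  exists y, delta x y = w /\ gallery y l z.
Proof.
  elim: l w => [|s l IH] w hl /=; first by rewrite mulw1 => e; exists z.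
  inversion hl as [|? ? hs hl']; subst; rewrite mulA => e.
  have [y1 [e1 h1]] := IH _ hl' e.
  have [y [ey exy]] := delta_ext x y1 s hs.
  exists y; rewrite exy e1 mulSK //; split=> //.
  exists y1; split=> //; exact: delta_symS.
Qed.

Lemma gallery_forth x y l : Forall isS l ->
  exists z, delta x z = delta x y ** prod l /\ gallery y l z.
Proof.
  elim: l y => [|s l IH] y hl /=; first by exists y; rewrite mulw1.
  inversion hl as [|? ? hs hl']; subst.
  have [y1 [e1 e2]] := delta_ext x y s hs.
  have [z [e3 h]] := IH y1 hl'.
  exists z; rewrite e3 e2 mulA; split=> //; by exists y1.
Qed.

Lemma gallery_of_delta x y l : Forall isS l -> delta x y = prod l -> gallery x l y.
Proof.
  rewrite -(mul1w (prod l)) => hl /(gallery_back _ _ _ _ hl) [x' [/delta_eq <- //]].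
Qed.

Lemma gallery_reduced x y l : Forall isS l -> gallery x l y -> length l = len (prod l) ->
  delta x y = prod l.
Proof.
  move=> hl h e; have := gallery_delta x x l y hl h.
  by rewrite delta_refl mul1w len_one; apply.
Qed.

(** Symmetry is not among the axioms; it comes from reversing a reduced gallery, since the type of a
    reduced gallery determines the distance of its ends. *)
Lemma delta_sym x y : delta y x = inv (delta x y).
Proof.
  have [l [hl [el e]]] := reduced_word (delta x y).
  have h := gallery_rev _ _ _ hl (gallery_of_delta x y l hl (eq_sym e)).
  rewrite -e -prod_rev //; apply: gallery_reduced => //; first exact: Forall_rev.
  by rewrite length_rev el prod_rev // e len_inv.
Qed.

Lemma delta_add x y z : len (delta x y ** delta y z) = len (delta x y) + len (delta y z) ->
  delta x z = delta x y ** delta y z.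
Proof.
  have [l [hl [el e]]] := reduced_word (delta y z).
  have h := gallery_of_delta y z l hl (eq_sym e).
  rewrite -el -e; exact: gallery_delta.
Qed.

(** No additivity of lengths is required: the third building axiom chooses, in each panel, a chamber
    at which the distance from [x] is really multiplied. *)
Lemma delta_end x y u : exists z, delta y z = u /\ delta x z = delta x y ** u.
Proof.
  have [l [hl [el e]]] := reduced_word u.
  have [z [e1 h]] := gallery_forth x y l hl.
  exists z; rewrite e1 e; split=> //; rewrite -e.
  apply: gallery_reduced => //; by rewrite el e.
Qed.

Lemma delta_start y z u : exists x, delta x y = u /\ delta x z = u ** delta y z.
Proof.
  have [x [e1 e2]] := delta_end z y (inv u).
  exists x; rewrite delta_sym e1 invK (delta_sym z x) e2 invM invK; split=> //.
  by rewrite -delta_sym.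
Qed.

Lemma delta_right (J : W -> Prop) x y z : (forall s, J s -> isS s) -> inW J (delta y z) ->
  exists v, inW J v /\ delta x z = delta x y ** v.
Proof.
  move=> JS [l [hl e]].
  have {e} := gallery_of_delta y z l (Forall_impl _ JS hl) (eq_sym e).
  elim: hl y => [|s {}l hs hl IH] y /=.
  - move=> ->; exists one; rewrite mulw1; split=> //; exact: inW_one.
  - move=> [y' [e /IH [v [hv ->]]]].
    case: (delta_step x y y' s (JS s hs) e) => ->; last by exists v.
    exists (s ** v); rewrite mulA; split=> //; apply: inW_mul => //; exact: inW_gen.
Qed.

Lemma delta_left (J : W -> Prop) x y z : (forall s, J s -> isS s) -> inW J (delta x y) ->
  exists u, inW J u /\ delta x z = u ** delta y z.
Proof.
  move=> JS h.
  have h' : inW J (delta y x) by rewrite delta_sym; exact: inW_inv.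
  have [v [hv e]] := delta_right J z y x JS h'.
  exists (inv v); split; first exact: inW_inv.
  by rewrite delta_sym e invM -delta_sym.
Qed.

(** By induction the two second chambers agree, so [y] and [y'] lie in one panel. If they differed,
    moving from one to the other would lengthen the distance from [x], which is the same for
    both. *)
Lemma gallery_mid_unique x y y' z l : Forall isS l -> gallery y l z -> gallery y' l z ->
  delta x y = delta x y' -> len (delta x y ** prod l) = len (delta x y) + length l -> y = y'.
Proof.
  elim: l y y' => [|s l IH] y y' hl /=; first by move=> -> ->.
  inversion hl as [|? ? hs hl']; subst => -[y1 [e h]] [y1' [e' h']] exy.
  rewrite mulA => elen.
  have h1 := len_mul (delta x y ** s) (prod l).
  have h2 := len_prod l hl'.
  have h3 := len_mul (delta x y) s; rewrite (len_S s hs) in h3.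
  have e1 : delta x y1 = delta x y ** s by apply: delta_step_up => //; lia.
  have e2 : delta x y1' = delta x y ** s by rewrite exy; apply: delta_step_up => //; rewrite -exy; lia.
  have ey1 : y1 = y1'.
  { apply: IH => //; first by rewrite e1 e2. rewrite e1; lia. }
  subst y1'.
  case: (delta_step y y1 y' s hs (delta_symS _ _ _ hs e')); rewrite e.
  - by rewrite SS // => /delta_eq.
  - move=> eyy'; have e3 : delta x y' = delta x y ** s by apply: delta_step_up => //; lia.
    have : len (delta x y) = len (delta x y ** s) by rewrite -e3 exy.
    lia.
Qed.

Lemma delta_mid_unique x y y' z : delta x y = delta x y' -> delta y z = delta y' z ->
  len (delta x y ** delta y z) = len (delta x y) + len (delta y z) -> y = y'.
Proof.
  have [l [hl [el e]]] := reduced_word (delta y z).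
  move=> e1 e2; rewrite -el -e.
  apply: gallery_mid_unique => //; apply: gallery_of_delta => //; by rewrite e.
Qed.

Section Thick.
Hypothesis HT : thick W S C delta.

(** Only one chamber [z0] of the panel is closer to [x]. Thickness provides a third chamber besides
    [y] and [z0], and stepping there from [z0] goes back up to the distance of [y]. *)
Lemma delta_fold x y s : isS s -> len (delta x y ** s) < len (delta x y) ->
  exists z, delta y z = s /\ delta x z = delta x y.
Proof.
  move=> hs lt.
  have [z0 [e1 e2]] := delta_ext x y s hs.
  have [z [ez nz]] : exists z, delta y z = s /\ z <> z0.
  { have [z1 [z2 [h1 [h2 ne]]]] := HT y s hs.
    case: (classic (z1 = z0)) => [ez|]; last by exists z1.
    by exists z2; split=> // ez'; apply: ne; rewrite ez. }
  exists z; split=> //.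
  have e3 : delta z0 z = s.
  { case: (delta_step z0 y z s hs ez); rewrite (delta_symS _ _ _ hs e1) //.
    by rewrite SS // => /delta_eq e; case: nz. }
  rewrite (delta_step_up x z0 z s hs e3); rewrite e2 mulSK //.
Qed.

End Thick.

Section LocallyFinite.
Hypothesis HF : locally_finite W S C delta.

Lemma galleries_finite l : Forall isS l -> forall x, exists L, forall y, gallery x l y -> In y L.
Proof.
  elim=> [|s {}l hs hl IH] x /=; first by exists [x] => y ->; left.
  have [L hL] := HF x s hs.
  exists (flat_map (fun z => proj1_sig (constructive_indefinite_description _ (IH z))) L).
  move=> y [z [e h]]; apply/in_flat_map; exists z; split; first exact: hL.
  by case: constructive_indefinite_description => /= L' h'; exact: h'.
Qed.

Lemma sphere_exists x w : exists l, NoDup l /\ forall y, In y l <-> delta x y = w.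
Proof.
  have [l [hl [el e]]] := reduced_word w.
  have [L hL] := galleries_finite l hl x.
  apply: (finite_NoDup _ (fun y => delta x y = w) L) => y h.
  by apply/hL/gallery_of_delta; rewrite // e.
Qed.

Definition sphere (x : C) (w : W) : list C :=
  proj1_sig (constructive_indefinite_description _ (sphere_exists x w)).

Lemma sphereP x w y : In y (sphere x w) <-> delta x y = w.
Proof. by rewrite /sphere; case: constructive_indefinite_description => l /= [_]. Qed.

Lemma sphere_NoDup x w : NoDup (sphere x w).
Proof. by rewrite /sphere; case: constructive_indefinite_description => l /= []. Qed.

Lemma residue_finite (J : W -> Prop) x : spherical W mul one S J ->
  exists l, NoDup l /\ forall y, In y l <-> residue W mul one C delta J x y.
Proof.
  move=> [_ [l hl]].
  apply: (finite_NoDup _ (residue W mul one C delta J x) (flat_map (sphere x) l)) => y h.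
  apply/in_flat_map; exists (delta x y); split; first exact: hl.
  exact/sphereP.
Qed.

End LocallyFinite.

(** * Coset covers, compactness and the tidiness criterion *)

Section Group.
Variable G : (C -> C) -> Prop.
Hypothesis HG : aut_group W C delta G.

Lemma G_aut f : G f -> tp_aut W C delta f. Proof. by case: HG => h _; exact: h. Qed.
Lemma G_delta f x y : G f -> delta (f x) (f y) = delta x y.
Proof. by move=> /G_aut [_ [_ h]]. Qed.
Lemma G_inj f x y : G f -> f x = f y -> x = y.
Proof. by move=> /G_aut [h _]; exact: h. Qed.
Lemma G_id : G (fun x => x). Proof. by case: HG => _ []. Qed.
Lemma G_comp f h : G f -> G h -> G (fun x => f (h x)).
Proof. by case: HG => _ [_ [H _]]; exact: H. Qed.
Lemma G_inv f : G f -> exists h, G h /\ (forall x, h (f x) = x) /\ (forall x, f (h x) = x).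
Proof.
  case: HG => _ [_ [_ H]] /H [h [Gh e]]; exists h; split=> //.
  by split=> x; case: (e x).
Qed.
Lemma G_iter f n : G f -> G (Nat.iter n f).
Proof. by move=> Gf; elim: n => [|n IH] /=; [exact: G_id | exact: G_comp]. Qed.

Local Notation subgroup := (subgroup_of_G C G).
Local Notation conjg := (conj_sub C).

(** An upper bound for the index of [K] over its intersection with [U]. The representatives are
    arbitrary maps and may repeat, so covers compose and restrict without further checks. *)
Definition coset_cover (K U : (C -> C) -> Prop) (k : nat) : Prop :=
  exists L, length L = k /\
    forall f, K f -> exists r h, In r L /\ U h /\ f = (fun x => r (h x)).

Lemma coset_cover_trans K V U k m :
  coset_cover K V k -> coset_cover V U m -> coset_cover K U (k * m).
Proof.
  move=> [L [<- hL]] [M [<- hM]].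
  exists (flat_map (fun r => map (fun t x => r (t x)) M) L); split.
  - apply: length_flat_map_const => r _; exact: length_map.
  - move=> f /hL [r [h [rL [/hM [t [u [tM [Uu ->]]]] ->]]]].
    exists (fun x => r (t x)), u; split=> //.
    apply/in_flat_map; exists r; split=> //; apply/in_map_iff; by exists t.
Qed.

Lemma coset_cover_conj K V g k : G g -> coset_cover K V k -> coset_cover (conjg K g) (conjg V g) k.
Proof.
  move=> /G_inv [g' [_ [g'g gg']]] [L [<- hL]].
  exists (map (fun r x => g (r (g' x))) L); split; first exact: length_map.
  move=> f [u [/hL [r [h [rL [Vh ->]]]] e]].
  exists (fun x => g (r (g' x))), (fun x => g (h (g' x))); split; [|split].
  - apply/in_map_iff; by exists r.
  - exists h; split=> // x; by rewrite g'g.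
  - apply: functional_extensionality => x; by rewrite g'g -e gg'.
Qed.

Lemma conj_comp V g h v : G g -> G h ->
  conjg V (fun x => h (g x)) v <-> conjg (conjg V g) h v.
Proof.
  move=> Gg Gh; have [g' [_ [g'g gg']]] := G_inv g Gg; split.
  - move=> [u [Vu e]]; exists (fun x => g (u (g' x))); split.
    + exists u; split=> // x; by rewrite g'g.
    + move=> x; by rewrite -e gg'.
  - move=> [v' [[u [Vu e]] e']]; exists u; split=> // x; by rewrite -e -e'.
Qed.

Lemma coset_cover_sub K K' U k : (forall f, K' f -> K f) -> coset_cover K U k -> coset_cover K' U k.
Proof. by move=> h [L [e hL]]; exists L; split=> // f /h /hL. Qed.

(** In the chain of conjugates of [V] by g^n, ..., g, 1, each member is covered by [m] cosets of the
    next. *)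
Lemma coset_cover_iter V g m n : G g -> subgroup V -> coset_cover (conjg V g) V m ->
  coset_cover (conjg V (Nat.iter n g)) V (m ^ n).
Proof.
  move=> Gg SV hm; elim: n => [|n IH] /=.
  - exists [fun x => x]; split=> // v [u [Vu e]]; exists (fun x => x), u; split; first by left.
    split=> //; exact: functional_extensionality.
  - rewrite Nat.mul_comm.
    apply: (coset_cover_sub (conjg (conjg V (Nat.iter n g)) g)).
    + move=> f h; apply/(conj_comp V _ g) => //; exact: G_iter.
    + apply: coset_cover_trans hm; exact: coset_cover_conj.
Qed.

Lemma subgroup_conj U g : G g -> subgroup U -> subgroup (conjg U g).
Proof.
  move=> Gg [UG [U1 [UM UV]]]; have [g' [Gg' [g'g gg']]] := G_inv g Gg.
  have conjE : forall u, conjg U g (fun x => g (u (g' x))) <-> U u.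
  { move=> u; split=> [[u' [Uu' e]] | Uu].
    - have -> : u = u' => //; apply: functional_extensionality => x.
      by apply: (G_inj g _ _ Gg); rewrite -e g'g.
    - by exists u; split=> // x; rewrite g'g. }
  have conjI : forall f, conjg U g f -> exists u, U u /\ f = (fun x => g (u (g' x))).
  { move=> f [u [Uu e]]; exists u; split=> //; apply: functional_extensionality => x.
    by rewrite -e gg'. }
  split; [|split; [|split]].
  - move=> f /conjI [u [/UG Gu ->]]; apply: G_comp => //; exact: G_comp.
  - by exists (fun x => x).
  - move=> f h [u [Uu eu]] [v [Uv ev]]; exists (fun x => u (v x)); split; first exact: UM.
    by move=> x; rewrite ev eu.
  - move=> f /conjI [u [/UV [v [Uv e]] ->]].
    exists (fun x => g (v (g' x))); split; first exact/conjE.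
    move=> x; rewrite !g'g; have [-> ->] := e (g' x); by rewrite gg'.
Qed.

Lemma index_cover K U n : index_is C K (fun h => K h /\ U h) n -> coset_cover K U n.
Proof.
  move=> [reps [e [_ [cov _]]]]; exists reps; split=> // f /cov [r [rL [h [[_ Uh] eh]]]].
  exists r, h; split=> //; split=> //; exact: functional_extensionality.
Qed.

Lemma inequivalent_reps (E : (C -> C) -> (C -> C) -> Prop) L :
  (forall f, E f f) -> (forall f h, E f h -> E h f) ->
  exists R, length R <= length L /\ incl R L /\ (forall f, In f L -> exists r, In r R /\ E r f) /\
    forall i j, i < length R -> j < length R ->
      E (nth i R (fun x => x)) (nth j R (fun x => x)) -> i = j.
Proof.
  move=> Erefl Esym; elim: L => [|f L [R [le [sub [cov ine]]]]].
  - exists nil; split=> //; split=> //; split=> // i j /=; lia.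
  - case: (classic (exists r, In r R /\ E r f)) => [[r [rR rf]]|no].
    + exists R; split; [simpl; lia | split; [by apply: incl_tl | split=> //]].
      move=> h [<- | /cov //]; by exists r.
    + exists (f :: R); split; [simpl; lia | split].
      * by move=> h /= [<- | /sub ?]; [left | right].
      * split.
        -- move=> h [<- | /cov [r [rR rh]]]; first by exists f; split; [left|].
           exists r; split=> //; by right.
        -- have out : forall i, i < length R -> E f (nth i R (fun x => x)) -> False.
           { move=> i hi h; apply: no; exists (nth i R (fun x => x)); split; first exact: nth_In.
             exact: Esym. }
           move=> [|i] [|j] //= hi hj h.
           ++ case: (out j) => //; lia.
           ++ case: (out i) => //; [lia | exact: Esym].
           ++ f_equal; apply: ine => //; lia.
Qed.

(** A coset of [U] that meets [K] meets it in one coset of the intersection. Each representative is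
    moved into [K] by [sel] where possible, and equivalent ones are then discarded. *)
Lemma cover_index K U k : subgroup K -> subgroup U -> coset_cover K U k ->
  exists n, n <= k /\ index_is C K (fun h => K h /\ U h) n.
Proof.
  move=> [KG [K1 [KM KV]]] [UG [U1 [UM UV]]] [L [<- hL]].
  pose P t r := K r /\ exists u, U u /\ r = (fun x => t (u x)).
  pose sel t := epsilon (inhabits (fun x : C => x)) (P t).
  have selP : forall t r, P t r -> P t (sel t).
  { by move=> t r h; apply: epsilon_spec; exists r. }
  pose E (f h : C -> C) := exists u, (K u /\ U u) /\ h = (fun x : C => f (u x)).
  pose L1 := filter (fun t => decide (K t)) (map sel L).
  have [R [le [sub [cov ine]]]] : exists R, length R <= length L1 /\ incl R L1 /\
    (forall f, In f L1 -> exists r, In r R /\ E r f) /\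
    forall i j, i < length R -> j < length R ->
      E (nth i R (fun x => x)) (nth j R (fun x => x)) -> i = j.
  { apply: inequivalent_reps.
    - by move=> f; exists (fun x => x).
    - move=> f h [u [[Ku Uu] ->]]; have [v [Kv ev]] := KV u Ku; have [v' [Uv' ev']] := UV u Uu.
      have vv' : v = v'.
      { apply: functional_extensionality => x; apply: (G_inj u); first exact: UG.
        by case: (ev x) => _ ->; case: (ev' x) => _ ->. }
      exists v; split; first by rewrite {2}vv'.
      apply: functional_extensionality => x; by case: (ev x) => _ ->. }
  have RK : forall r, In r R -> K r.
  { by move=> r /sub /filter_In [_ /decideP]. }
  exists (length R); split.
  - have := filter_length_le (fun t => decide (K t)) (map sel L).
    rewrite length_map -/L1; lia.
  - exists R; split=> //; split=> //; split.
    + move=> v Kv; have [t [u [tL [Uu ev]]]] := hL v Kv.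
      have [Ks [u' [Uu' es]]] := selP t v (conj Kv (ex_intro _ u (conj Uu ev))).
      have tL1 : In (sel t) L1.
      { apply/filter_In; split; last by apply/decideP. apply/in_map_iff; by exists t. }
      have [r [rR [q [[Kq Uq] eq]]]] := cov (sel t) tL1.
      exists r; split=> //.
      have [p [Kp ep]] := KV _ (RK _ rR).
      have [w' [Uw' ew']] := UV _ Uu'.
      have e : forall x, v x = r (q (w' (u x))).
      { move=> x; rewrite -[RHS](equal_f eq) es ev; by case: (ew' (u x)) => _ ->. }
      exists (fun x => q (w' (u x))); split=> //.
      split; last by apply: (UM) => //; exact: UM.
      have -> : (fun x => q (w' (u x))) = (fun x => p (v x)); last exact: KM.
      apply: functional_extensionality => x; rewrite e; by case: (ep (q (w' (u x)))).
    + move=> i j hi hj [u [Ku e]]; apply: ine => //; exists u; split=> //.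
      exact: functional_extensionality.
Qed.

Lemma tidy_cover U g : G g ->
  tidy C G U g <-> compact_open_subgroup C G U /\
    exists d, coset_cover (conjg U g) U d /\
      forall V k, compact_open_subgroup C G V -> coset_cover (conjg V g) V k -> d <= k.
Proof.
  move=> Gg; split.
  - move=> [UC [n [hn least]]]; split=> //; exists n; split; first exact: index_cover.
    move=> V k VC hk; have SV := proj1 VC.
    have [m [le hm]] := cover_index _ _ _ (subgroup_conj V g Gg SV) SV hk.
    exact: Nat.le_trans (least V m VC hm) le.
  - move=> [UC [d [hd least]]]; split=> //; have SU := proj1 UC.
    have [n [le hn]] := cover_index _ _ _ (subgroup_conj U g Gg SU) SU hd.
    exists n; split=> // V m VC /index_cover hm.
    exact: Nat.le_trans le (least V m VC hm).
Qed.

Lemma compact_cover V U : compact_open_subgroup C G V -> compact_open_subgroup C G U ->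
  exists k, coset_cover V U k.
Proof.
  move=> [[VG _] [_ [_ Vc]]] [[UG [U1 _]] [[_ Uo] _]].
  (* The coset of [U] at [r], made empty when [r] is outside [G] so that every member of the family
     is open. *)
  pose O r f := G f /\ G r /\ exists h, U h /\ f = (fun x : C => r (h x)).
  have [|f Vf|L hL] := Vc (C -> C) O.
  - move=> r; split; first by move=> f [].
    move=> f [Gf [Gr [h [Uh ->]]]]; have [F hF] := Uo h Uh.
    have [r' [Gr' [r'r rr']]] := G_inv r Gr.
    exists F => f' Gf' e; split=> //; split=> //; exists (fun x => r' (f' x)); split.
    + apply: hF; first exact: G_comp.
      by move=> x /e ->.
    + apply: functional_extensionality => x; by rewrite rr'.
  - exists f; split; first exact: VG. split; first exact: VG. by exists (fun x => x).
  - exists (length L), L; split=> // f /hL [r [rL [_ [_ [h [Uh ->]]]]]].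
    by exists r, h.
Qed.

(** * Compactness of open subgroups with a finite orbit *)

Section Compact.
Hypothesis HF : locally_finite W S C delta.
Hypothesis HCl : closed_group W C delta G.

Lemma ball_finite k : exists l, forall w, len w <= k -> In w l.
Proof.
  elim: k => [|k [l hl]].
  - exists [one] => w h; left; symmetry; apply: len_eq0; lia.
  - exists (l ++ flat_map (fun w => map (mul w) S) l) => w h.
    have [lw [hlw [elw ew]]] := reduced_word w.
    apply/in_or_app.
    elim/rev_ind: lw hlw elw ew => [|s lw _] hlw elw ew.
    + left; apply: hl; rewrite -elw /=; lia.
    + right; apply/in_flat_map; exists (prod lw).
      move/Forall_app: hlw => [hlw /(Forall_inv (P := isS)) hs].
      split; last by apply/in_map_iff; exists s; rewrite -ew prod_app /= mulw1.
      apply: hl; have := len_prod lw hlw; rewrite length_app /= in elw; lia.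
Qed.

(** A König argument: if no finite subcover exists, values on growing balls around [c0] can be
    frozen one after another while the remaining set stays uncoverable. The limit lies in [V], hence
    in some [O i], which then contains a whole late stage. *)
Lemma open_subgroup_compact V c0 L :
  subgroup V -> open_in_G C G V -> (forall f, V f -> In (f c0) L) -> compact_in_G C G V.
Proof.
  move=> [VG [V1 [VM VV]]] [_ Vo] orb; split=> // I O Oopen cov.
  apply: NNPP => no.
  pose covered (A : (C -> C) -> Prop) := exists l : list I, forall f, A f -> exists i, In i l /\ O i f.
  have cov_sub : forall A B, (forall f, A f -> B f) -> covered B -> covered A.
  { move=> A B h [l hl]; by exists l => f /h /hl. }
  (* [f x] has finitely many possible values: [f c0] lies in [L], and [f x] is at distance
     [delta c0 x] from it. *)
  have split_value : forall A x, (forall f, A f -> V f) -> ~ covered A ->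
    exists y, ~ covered (fun f => A f /\ f x = y).
  { move=> A x AV nA; apply: NNPP => ny; apply: nA.
    pose M := flat_map (fun c => sphere HF c (delta c0 x)) L.
    have fin : forall M', covered (fun f => A f /\ In (f x) M').
    { elim=> [|y M' [l hl]]; first by exists nil => f [].
      have [l' hl'] : covered (fun f => A f /\ f x = y) by apply: NNPP => h; apply: ny; exists y.
      exists (l' ++ l) => f [Af [e | h]].
      - have [i [il Oi]] := hl' f (conj Af (eq_sym e)); exists i; split=> //; apply/in_or_app; by left.
      - have [i [il Oi]] := hl f (conj Af h); exists i; split=> //; apply/in_or_app; by right. }
    apply: cov_sub (fin M) => f Af; split=> //; apply/in_flat_map; exists (f c0).
    split; first by apply/orb/AV.
    by apply/sphereP; apply: G_delta; apply/VG/AV. }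
  have split_list : forall F A, (forall f, A f -> V f) -> ~ covered A ->
    exists phi, A phi /\ ~ covered (fun f => A f /\ forall x, In x F -> f x = phi x).
  { elim=> [|x F IH] A AV nA.
    - have [phi Aphi] : exists phi, A phi.
      { apply: NNPP => ne; apply: nA; exists nil => f Af; case: ne; by exists f. }
      exists phi; split=> // h; apply: nA; by apply: cov_sub h => f Af; split.
    - have [y ny] := split_value A x AV nA.
      have [phi [[Aphi ex] nphi]] := IH _ (fun f h => AV f (proj1 h)) ny.
      exists phi; split=> // h; apply: nphi; apply: cov_sub h => f [[Af fx] e]; split=> //.
      move=> z [<- | /e //]; by rewrite fx ex. }
  pose good A F phi := A phi /\ ~ covered (fun f => A f /\ forall x, In x F -> f x = phi x).
  pose pick A F := epsilon (inhabits (fun x : C => x)) (good A F).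
  have ball : forall k, exists B, forall x, len (delta c0 x) <= k -> In x B.
  { move=> k; have [l hl] := ball_finite k.
    exists (flat_map (sphere HF c0) l) => x h; apply/in_flat_map; exists (delta c0 x).
    by split; [exact: hl | exact/sphereP]. }
  pose B k := proj1_sig (constructive_indefinite_description _ (ball k)).
  have BP : forall k x, len (delta c0 x) <= k -> In x (B k).
  { by move=> k; rewrite /B; case: constructive_indefinite_description. }
  pose A := fix A k := match k with
    | 0 => V
    | Datatypes.S k => fun f => A k f /\ forall x, In x (B k) -> f x = pick (A k) (B k) x
    end.
  have AS : forall k f, A (Datatypes.S k) f =
    (A k f /\ forall x, In x (B k) -> f x = pick (A k) (B k) x) by [].
  have AP : forall k, (forall f, A k f -> V f) /\ ~ covered (A k).
  { elim=> [|k [AV nA]]; first by split=> // h; exact: no.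
    split; first by move=> f [/AV].
    exact: (proj2 (epsilon_spec (inhabits (fun x : C => x)) _ (split_list (B k) (A k) AV nA))). }
  have Amono : forall j k f, A (k + j) f -> A k f.
  { elim=> [|j IH] k f; first by rewrite Nat.add_0_r.
    by rewrite Nat.add_succ_r AS => -[/IH]. }
  (* The limit takes at [x] the value frozen at the stage given by the radius of [x] itself; later
     stages agree with it. *)
  pose f x := pick (A (len (delta c0 x))) (B (len (delta c0 x))) x.
  have agree : forall k h x, A (Datatypes.S k) h -> len (delta c0 x) <= k -> h x = f x.
  { move=> k h x hk le.
    have : A (Datatypes.S (len (delta c0 x))) h.
    { apply: (Amono (k - len (delta c0 x))).
      have -> // : Datatypes.S (len (delta c0 x)) + (k - len (delta c0 x)) = Datatypes.S k by lia. }
    rewrite AS => -[_]; apply; exact: BP. }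
  have bound : forall F : list C, exists k, forall x, In x F -> len (delta c0 x) <= k.
  { elim=> [|x F [k hk]]; first by exists 0.
    exists (Nat.max k (len (delta c0 x))) => z [<- | /hk]; lia. }
  have approx : forall F : list C, exists h, V h /\ forall x, In x F -> h x = f x.
  { move=> F; have [k hk] := bound F.
    have [AV nA] := AP (Datatypes.S k).
    have [h Ah] : exists h, A (Datatypes.S k) h.
    { apply: NNPP => ne; apply: nA; exists nil => h Ah; case: ne; by exists h. }
    exists h; split; first exact: AV. move=> x /hk; exact: agree. }
  have f_delta : forall x y, delta (f x) (f y) = delta x y.
  { move=> x y; have [h [Vh e]] := approx [x; y].
    rewrite -!e; [by apply/G_delta/VG | by right; left | by left]. }
  have f_aut : tp_aut W C delta f.
  { split; [|split=> //].
    - move=> x y e; apply/delta_eq; by rewrite -f_delta e delta_refl.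
    (* A preimage of [z] under an approximant that agrees at [c0] lies on this sphere around [c0],
       where the approximant agrees with [f]. *)
    - move=> z; have [h [Vh e]] := approx (c0 :: sphere HF c0 (delta (f c0) z)).
      have [_ [h_surj _]] := G_aut h (VG h Vh).
      have [x ex] := h_surj z; exists x; rewrite -e //; right; apply/sphereP.
      rewrite -(G_delta h c0 x (VG h Vh)) ex e //; by left. }
  have Gf : G f.
  { apply: HCl => // F; have [h [Vh e]] := approx F; exists h; split=> //; exact: VG. }
  (* Open subgroups are closed: an approximant h in [V] makes h^-1 f close to the identity, hence a
     member of [V]. *)
  have Vf : V f.
  { have [F hF] := Vo _ V1; have [h [Vh e]] := approx F.
    have [h' [Vh' e']] := VV h Vh.
    have -> : f = (fun x => h (h' (f x))).
    { apply: functional_extensionality => x; by case: (e' (f x)). }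
    apply: VM => //; apply: hF; first by apply: G_comp => //; exact: VG.
    move=> x xF; rewrite -e //; by case: (e' x). }
  have [i Oi] := cov f Vf.
  have [_ hO] := Oopen i; have [F hF] := hO f Oi.
  have [k hk] := bound F.
  have [AV nA] := AP (Datatypes.S k).
  apply: nA; exists [i] => h Ah; exists i; split; first by left.
  apply: hF; first by apply/VG/AV.
  move=> x /hk; exact: agree.
Qed.

End Compact.

(** * Stabilizers of residues *)

Section Residues.
Hypothesis HF : locally_finite W S C delta.
Hypothesis HCl : closed_group W C delta G.
Hypothesis HT : weyl_transitive W C delta G.

Local Notation res J := (residue W mul one C delta J).
Local Notation N x v := (length (sphere HF x v)).

Lemma N_const x y v : N x v = N y v.
Proof.
  have le : forall x y, N x v <= N y v; last by apply: Nat.le_antisymm.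
  move=> {}x {}y.
  have [g [Gg [gx _]]] : exists g, G g /\ g x = y /\ g x = y by apply: HT; rewrite !delta_refl.
  apply: (pigeonhole _ _ (fun p q => g p = q)); first exact: sphere_NoDup.
  - move=> p /sphereP e; exists (g p); split=> //; apply/sphereP; by rewrite -gx G_delta.
  - move=> p p' q _ _ <- e; exact: (G_inj g _ _ Gg (eq_sym e)).
Qed.

(** With additive lengths the chamber at distance [v] on the way to the end is unique, so the
    spheres around these chambers are disjoint. *)
Lemma N_mul x v u : len (v ** u) = len v + len u -> N x v * N x u <= N x (v ** u).
Proof.
  move=> e.
  rewrite -(length_flat_map_const _ _ (fun y => sphere HF y u)); last by move=> y _; exact: N_const.
  apply: NoDup_incl_length.
  - apply: NoDup_flat_map; first exact: sphere_NoDup.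
    + move=> y _; exact: sphere_NoDup.
    + move=> y y' z /sphereP e1 /sphereP e2 /sphereP e3 /sphereP e4.
      apply: (delta_mid_unique x y y' z); by rewrite ?e1 ?e2 ?e3 ?e4.
  - move=> z /in_flat_map [y [/sphereP e1 /sphereP e2]]; apply/sphereP.
    by rewrite (delta_add x y z) e1 e2.
Qed.

Section OneType.
Variable J : W -> Prop.
Hypothesis HJ : spherical W mul one S J.

Lemma J_S s : J s -> isS s. Proof. by case: HJ => h _; exact: h. Qed.

Lemma res_refl x : res J x x. Proof. by rewrite /residue delta_refl; exact: inW_one. Qed.
Lemma res_sym x y : res J x y -> res J y x.
Proof. by move=> h; rewrite /residue (delta_sym x y); apply: inW_inv => //; exact: J_S. Qed.
Lemma res_trans x y z : res J x y -> res J y z -> res J x z.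
Proof.
  move=> h1 h2; have [v [hv]] := delta_right J x y z J_S h2.
  rewrite /residue => ->; exact: inW_mul.
Qed.
Lemma res_G g x y : G g -> res J (g x) (g y) <-> res J x y.
Proof. by move=> Gg; rewrite /residue G_delta. Qed.

Lemma gallery_res x l y : Forall J l -> gallery x l y -> res J x y.
Proof.
  elim: l x => [|s l IH] x hl /=; first by move=> ->; exact: res_refl.
  inversion hl; subst => -[z [e h]]; apply: (res_trans _ z); last exact: IH.
  by rewrite /residue e; exact: inW_gen.
Qed.

(** The projection of [x] to a residue is encoded as the chamber whose distance from [x] is shortest
    in its coset of W_J. *)
Lemma gate_unique x y y' : res J y y' -> min_right J (delta x y) -> min_right J (delta x y') -> y = y'.
Proof.
  move=> h h1 h2; apply/delta_eq/(min_right_unique J J_S (delta x y)) => //.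
  rewrite -(delta_add x y y') //; exact: (min_right_len J J_S).
Qed.

Lemma double_coset_realized x y u v : inW J u -> inW J v ->
  exists x' y', res J x x' /\ res J y y' /\ delta x' y' = u ** delta x y ** v.
Proof.
  move=> hu hv; have [x' [e1 e2]] := delta_start x y u; have [y' [e3 e4]] := delta_end x' y v.
  exists x', y'; split; last split.
  - by apply: res_sym; rewrite /residue e1.
  - by rewrite /residue e3.
  - by rewrite e4 e2.
Qed.

Lemma delta_double_coset x y x' y' : res J x x' -> res J y y' ->
  exists u v, inW J u /\ inW J v /\ delta x' y' = u ** delta x y ** v.
Proof.
  move=> /res_sym h1 h2.
  have [u [hu e1]] := delta_left J x' x y J_S h1.
  have [v [hv e2]] := delta_right J x' y y' J_S h2.
  by exists u, v; rewrite e2 e1.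
Qed.

(** Despite the name, the residues are stabilized, not fixed chamberwise. A list of chambers gives
    intersections of stabilizers, and one chamber per residue is enough to test. *)
Definition fixer (X : list C) (f : C -> C) : Prop := G f /\ forall x, In x X -> res J x (f x).

Lemma fixer1 x f : fixer [x] f <-> G f /\ res J x (f x).
Proof. split=> -[Gf h]; split=> //; [by apply: h; left | by move=> y [<-|]]. Qed.

Lemma fixer_subgroup X : subgroup (fixer X).
Proof.
  split; first by move=> f [].
  split; first by split; [exact: G_id | move=> x _; exact: res_refl].
  split.
  - move=> f h [Gf hf] [Gh hh]; split; first exact: G_comp.
    move=> x xX; apply: (res_trans _ _ _ (hf x xX)); apply/res_G => //; exact: hh.
  - move=> f [Gf hf]; have [h [Gh [e1 e2]]] := G_inv f Gf.
    exists h; split; last by move=> x; rewrite e1 e2.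
    split=> // x xX; apply/(res_G f) => //; rewrite e2; apply: res_sym; exact: hf.
Qed.

Lemma fixer_residue x x' f : res J x x' -> fixer [x] f -> fixer [x'] f.
Proof.
  move=> h /fixer1 [Gf hf]; apply/fixer1; split=> //.
  apply: (res_trans _ _ _ (res_sym _ _ h)); apply: (res_trans _ _ _ hf); exact/res_G.
Qed.

Lemma fixer_conj X g f : G g -> conjg (fixer X) g f <-> fixer (map g X) f.
Proof.
  move=> Gg; have [g' [Gg' [g'g gg']]] := G_inv g Gg; split.
  - move=> [u [[Gu hu] e]].
    have -> : f = (fun x => g (u (g' x))) by apply: functional_extensionality => x; rewrite -e gg'.
    split; first by apply: G_comp => //; exact: G_comp.
    move=> y /in_map_iff [x [<- xX]]; rewrite g'g; apply/res_G => //; exact: hu.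
  - move=> [Gf hf]; exists (fun x => g' (f (g x))); split; last by move=> x; rewrite gg'.
    split; first by apply: G_comp => //; exact: G_comp.
    move=> x xX; apply/(res_G g) => //; rewrite gg'; apply: hf; exact: in_map.
Qed.

Lemma stabilizer_fixer x f : stabilizer C G (res J x) f <-> fixer [x] f.
Proof.
  rewrite fixer1; split.
  - move=> [Gf [h _]]; split=> //; apply: h; exact: res_refl.
  - move=> [Gf h]; have [f' [Gf' [_ ff']]] := G_inv f Gf; split=> //; split.
    + move=> y hy; apply: (res_trans _ _ _ h); exact/res_G.
    + move=> z hz; exists (f' z); split; last exact: ff'.
      apply/(res_G f) => //; rewrite ff'; apply: res_trans hz; exact: res_sym.
Qed.

Lemma image_residue g x z : G g -> image_res C g (res J x) z <-> res J (g x) z.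
Proof.
  move=> Gg; have [g' [Gg' [_ gg']]] := G_inv g Gg; split.
  - by move=> [y [h <-]]; apply/res_G.
  - move=> h; exists (g' z); split=> //; apply/(res_G g) => //; by rewrite gg'.
Qed.

Lemma fixer_compact_open x X : compact_open_subgroup C G (fixer (x :: X)).
Proof.
  have SV := fixer_subgroup (x :: X).
  have Vo : open_in_G C G (fixer (x :: X)).
  { split; first by move=> f [].
    move=> f [Gf hf]; exists (x :: X) => h Gh e; split=> // y yX; rewrite e //; exact: hf. }
  split=> //; split=> //.
  have [l [_ hl]] := residue_finite HF J x HJ.
  apply: (open_subgroup_compact HF HCl _ x l) => // f [_ h]; apply/hl/h; by left.
Qed.

(** Since [w] conjugates W_J into itself, every translate of the residue of [x] by the stabilizer of
    the residue of [z] has a chamber at distance [inv w] from [z]. One representative per chamber of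
    that sphere therefore suffices. *)
Lemma parallel_cover z x w : delta z x = inv w ->
  (forall u, inW J u -> inW J (w ** u ** inv w)) ->
  coset_cover (fixer [z]) (fixer [x]) (N z (inv w)).
Proof.
  move=> e norm.
  pose sel y := epsilon (inhabits (fun p : C => p)) (fun r => fixer [z] r /\ res J y (r x)).
  exists (map sel (sphere HF z (inv w))); split; first exact: length_map.
  move=> h /[dup] fh /fixer1 [Gh hh]; have [h' [Gh' [h'h hh']]] := G_inv h Gh.
  have hz : res J (h' z) z by apply/(res_G h) => //; rewrite hh'.
  have [u [hu eu]] := delta_left J (h' z) z x J_S hz.
  have [y [e1 e2]] := delta_end (h' z) x (inv (w ** u ** inv w)).
  have xy : res J x y by rewrite /residue e1; apply: inW_inv; [exact: J_S | exact: norm].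
  have ez : delta z (h y) = inv w.
  { by rewrite -{1}(hh' z) G_delta // e2 eu e !invM invK !mulA mulVK mulwV mul1w. }
  have [fr hr] : fixer [z] (sel (h y)) /\ res J (h y) (sel (h y) x).
  { apply: (epsilon_spec (inhabits (fun p : C => p))
             (fun r => fixer [z] r /\ res J (h y) (r x))).
    exists h; split=> //; apply/res_G => //; exact: res_sym. }
  have [Gr _] := fr; have [r' [Gr' [r'r rr']]] := G_inv _ Gr.
  exists (sel (h y)), (fun p => r' (h p)); split; [|split].
  - apply/in_map_iff; exists (h y); split=> //; exact/sphereP.
  - apply/fixer1; split; first exact: G_comp.
    apply/(res_G (sel (h y))) => //; rewrite rr'; apply: (res_trans _ (h y)); first exact: res_sym.
    apply/res_G => //; exact: res_sym.
  - by apply: functional_extensionality => p; rewrite rr'.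
Qed.

(** Conversely, cosets bound chambers: Weyl-transitivity moves [(z1, y0)] to [(z2, y)] by an element
    stabilizing the residue of [z], so [y] lies in one of [k] translates of the residue of [x]. *)
Lemma cover_chambers z x k l : coset_cover (fixer [z]) (fixer [x]) k ->
  (forall y, In y l <-> res J x y) ->
  exists T, length T = k * length l /\
    forall y y0 z1 z2, res J x y0 -> res J z z1 -> res J z z2 ->
      delta z2 y = delta z1 y0 -> In y T.
Proof.
  move=> [L [<- hL]] hl.
  exists (flat_map (fun r => map r l) L); split.
  - apply: length_flat_map_const => r _; exact: length_map.
  - move=> y y0 z1 z2 xy0 zz1 zz2 e.
    have [h [Gh [hz hy]]] := HT _ _ _ _ (eq_sym e).
    have fh : fixer [z] h.
    { apply: (fixer_residue z1); first exact: res_sym.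
      apply/fixer1; split=> //; rewrite hz; apply: res_trans zz2; exact: res_sym. }
    have [r [u [rL [/fixer1 [Gu hu] eh]]]] := hL h fh.
    apply/in_flat_map; exists r; split=> //; apply/in_map_iff; exists (u y0).
    split; first by rewrite -hy eh.
    apply/hl; apply: (res_trans _ _ _ hu); exact/res_G.
Qed.

(** If the coset of some [f] in [K] missed [H], the other d - 1 cosets would already cover [H]. *)
Lemma transitive_of_index H K U d : subgroup H -> subgroup U -> (forall f, H f -> K f) ->
  coset_cover K U d -> (forall k, coset_cover H (fun f => H f /\ U f) k -> d <= k) ->
  forall f, K f -> exists h u, H h /\ U u /\ f = (fun x => h (u x)).
Proof.
  move=> [HG' [H1 [HM HV]]] [UG [U1 [UM UV]]] HK [L [eL hL]] least f Kf; apply: NNPP => no.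
  have [r [u [rL [Uu ef]]]] := hL f Kf.
  have [L1 [L2 eL']] := in_split _ _ rL.
  pose P t q := H q /\ exists v, U v /\ q = (fun x : C => t (v x)).
  pose sel t := epsilon (inhabits (fun x : C => x)) (P t).
  have : coset_cover H (fun f => H f /\ U f) (length (L1 ++ L2)).
  { exists (map sel (L1 ++ L2)); split; first exact: length_map.
    move=> q Hq; have [t [v [tL [Uv eq]]]] := hL q (HK q Hq).
    have [v' [Uv' ev']] := UV v Uv.
    have tL' : In t (L1 ++ L2).
    { move: tL; rewrite eL' !in_app_iff /= => -[|[et|]]; auto.
      case: no; exists q, (fun x => v' (u x)); split=> //; split; first exact: UM.
      apply: functional_extensionality => x; rewrite ef eq et; by case: (ev' (u x)) => _ ->. }
    have [Hs [v2 [Uv2 es]]] : P t (sel t).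
    { apply: epsilon_spec; exists q; split=> //; by exists v. }
    have [v2' [Uv2' ev2']] := UV v2 Uv2.
    have [s' [Hs' es']] := HV _ Hs.
    have e : q = (fun x => sel t (v2' (v x))).
    { apply: functional_extensionality => x; rewrite es eq; by case: (ev2' (v x)) => _ ->. }
    exists (sel t), (fun x => v2' (v x)); split; first exact: in_map.
    split=> //; split; last exact: UM.
    have -> : (fun x => v2' (v x)) = (fun x => s' (q x)); last exact: HM.
    apply: functional_extensionality => x; rewrite e; by case: (es' (v2' (v x))). }
  move=> /least; rewrite -eL eL' !length_app /=; lia.
Qed.

End OneType.

Lemma conj_parabolic (J : W -> Prop) w :
  (forall s, J s -> J (w ** s ** inv w)) -> forall u, inW J u -> inW J (w ** u ** inv w).
Proof.
  move=> h u [l [hl <-]]; elim: hl => [|s {}l hs hl IH] /=.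
  - rewrite mulw1 mulwV; exact: inW_one.
  - have -> : w ** (s ** prod l) ** inv w = (w ** s ** inv w) ** (w ** prod l ** inv w).
    { by rewrite !mulA mulVK. }
    apply: inW_mul => //; apply: inW_gen; exact: h.
Qed.

Lemma conj_pow_parabolic (J : W -> Prop) w :
  (forall u, inW J u -> inW J (w ** u ** inv w)) ->
  forall n u, inW J u -> inW J (pow w n ** u ** inv (pow w n)).
Proof.
  move=> h; elim=> [|n IH] u hu /=; first by rewrite inv1 mul1w mulw1.
  have := h _ (IH _ hu); by rewrite invM !mulA.
Qed.

Lemma min_double_pair J a b : spherical W mul one S J ->
  exists y z, res J a y /\ res J b z /\ min_double J (delta y z).
Proof.
  move=> HJ.
  have [n [[y [z [hy [hz en]]]] least]] :=
    ex_least (fun n => exists y z, res J a y /\ res J b z /\ len (delta y z) = n)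
      (ex_intro _ _ (ex_intro _ a (ex_intro _ b (conj (res_refl J a) (conj (res_refl J b) eq_refl))))).
  exists y, z; split=> //; split=> // u v hu hv.
  have [y' [z' [hy' [hz' <-]]]] := double_coset_realized J HJ y z u v hu hv.
  rewrite en; apply: least; exists y', z'; split; first exact: (res_trans J HJ _ y).
  split=> //; exact: (res_trans J HJ _ z).
Qed.

(** The distances between the two residues form one double coset of W_J, and the normal form shows
    that its shortest element is unique. *)
Lemma res_dist_min_double J a g w : spherical W mul one S J -> G g ->
  res_dist W mul one S C delta (res J a) (image_res C g (res J a)) w <->
  (exists y z, res J a y /\ res J (g a) z /\ delta y z = w) /\ min_double J w.
Proof.
  move=> HJ Gg; split.
  - move=> [[y [z [hy [/(image_residue J _ _ _ Gg) hz e]]]] least].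
    split; first by exists y, z.
    move=> u v hu hv.
    have [y' [z' [hy' [hz' e']]]] := double_coset_realized J HJ y z u v hu hv.
    rewrite -{2}e -e'; case: (classic (delta y' z' = w)) => [-> // | ne].
    apply: Nat.lt_le_incl; apply: (least y' z' _ _ ne); try exact: lenP.
    + exact: (res_trans J HJ _ y).
    + apply/(image_residue J _ _ _ Gg) => //; exact: (res_trans J HJ _ z).
  - move=> [[y [z [hy [hz e]]]] hw]; split.
    + exists y, z; split=> //; split=> //; exact/(image_residue J _ _ _ Gg).
    + move=> y' z' hy' /(image_residue J _ _ _ Gg) hz' ne n m /has_lengthE -> /has_lengthE ->.
      have [u [v [hu [hv e']]]] := delta_double_coset J HJ y z y' z'
        (res_trans J HJ _ _ _ (res_sym J HJ _ _ hy) hy')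
        (res_trans J HJ _ _ _ (res_sym J HJ _ _ hz) hz').
      rewrite e in e'.
      have [u' [v' [hu' [hv' [e2 elen]]]]] := double_coset_normal_form J (J_S J HJ) w u v hw hu hv.
      rewrite e' elen.
      case: (Nat.eq_dec (len u' + len v') 0) => h0; last lia.
      case: ne; rewrite e' e2 (len_eq0 u'); last lia. rewrite (len_eq0 v'); last lia.
      by rewrite mul1w mulw1.
Qed.

(** Lengths are assumed additive only up to [m], because the tidy direction uses this inside an
    induction on [m]. *)
Lemma delta_pow_realized J a g w m : spherical W mul one S J -> G g ->
  (exists y z, res J a y /\ res J (g a) z /\ delta y z = w) ->
  (forall u, inW J u -> inW J (inv w ** u ** w)) ->
  (forall i, i <= m -> len (pow w i) = i * len w) ->
  forall y, res J a y -> exists z, res J (Nat.iter m g a) z /\ delta y z = pow w m.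
Proof.
  move=> HJ Gg [y0 [z0 [hy0 [hz0 e0]]]] norm.
  have step : forall y, res J a y -> exists z, res J (g a) z /\ delta y z = w.
  { move=> y hy.
    have [u [hu e1]] := delta_left J y y0 z0 (J_S J HJ) (res_trans J HJ _ _ _ (res_sym J HJ _ _ hy) hy0).
    have [z [e2 e3]] := delta_end y z0 (inv (inv w ** u ** w)).
    exists z; split.
    - apply: (res_trans J HJ _ z0) => //; rewrite /residue e2.
      apply: inW_inv; [exact: J_S | exact: norm].
    - by rewrite e3 e1 e0 !invM invK !mulA mulK mulwV mul1w. }
  elim: m => [|m IH] hlen y hy /=; first by exists y; rewrite delta_refl.
  have [z1 [hz1 e1]] := step y hy.
  have [g' [Gg' [g'g gg']]] := G_inv g Gg.
  have hy1 : res J a (g' z1) by apply/(res_G J g) => //; rewrite gg'.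
  have [z [hz e2]] := IH (fun i le => hlen i (Nat.le_le_succ_r _ _ le)) _ hy1.
  have e3 : delta z1 (g z) = pow w m by rewrite -{1}(gg' z1) G_delta.
  exists (g z); split; first exact/res_G.
  rewrite (delta_add y z1 (g z)) e1 e3 //.
  have := hlen (Datatypes.S m) (le_n _); rewrite /= => ->.
  rewrite (hlen m) //; lia.
Qed.

(** * A straight displacement makes the stabilizer tidy *)

Lemma pow_le_bound N0 K m : (forall n, N0 ^ n <= K * m ^ n) -> N0 <= m.
Proof.
  move=> h; case: (le_lt_dec N0 m) => // lt.
  case: m h lt => [|m] h lt; first by have := h 1; rewrite /=; lia.
  pose p := Datatypes.S m.
  (* Bernoulli's inequality (1 + 1/p)^n >= 1 + n/p, cleared of denominators. *)
  have bern : forall n, p ^ n * (p + n) <= p * Datatypes.S p ^ n.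
  { elim=> [|n IH]; first by rewrite /=; lia.
    rewrite !Nat.pow_succ_r'; nia. }
  (* With this exponent 1 + n/p equals K + 1, just beyond the assumed constant. *)
  pose n := K * p.
  have h1 : Datatypes.S p ^ n <= N0 ^ n by apply: Nat.pow_le_mono_l.
  have h2 := h n; have h3 := bern n.
  have h4 : 0 < p ^ n by have := Nat.pow_nonzero p n; rewrite /p; lia.
  have h5 : p ^ n * (p + n) <= p * (K * p ^ n) by apply: (Nat.le_trans _ _ _ h3); apply: Nat.mul_le_mono_l; exact: Nat.le_trans h1 h2.
  have h6 : p ^ n * (p + n) = p ^ n * p + p * (K * p ^ n).
  { rewrite Nat.mul_add_distr_l {3}/n; lia. }
  have : 0 < p ^ n * p by rewrite /p; nia.
  lia.
Qed.

Lemma straight_tidy J a g w : spherical W mul one S J -> G g ->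
  (exists y z, res J a y /\ res J (g a) z /\ delta y z = w) ->
  straight W mul one inv S J w -> tidy C G (fixer J [a]) g.
Proof.
  move=> HJ Gg hex [_ [norm [norm' lenw]]].
  have hlen : forall n, len (pow w n) = n * len w.
  { move=> n; symmetry; apply/has_lengthE; exact/lenw/lenP. }
  have hnorm := conj_parabolic J w norm.
  have hnorm' : forall u, inW J u -> inW J (inv w ** u ** w).
  { move=> u hu; rewrite -{2}(invK w); apply: conj_parabolic hu => t /norm' [s [hs <-]].
    by rewrite invK !mulA mulVw mul1w mulVK. }
  have [y0 [z0 [hy0 [hz0 e0]]]] := hex.
  have aco := fixer_compact_open J HJ.
  apply/tidy_cover => //; split; first exact: aco.
  exists (N z0 (inv w)); split.
  - apply: (coset_cover_sub (fixer J [z0])).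
    + move=> f /(fixer_conj J [a] g f Gg); exact: fixer_residue.
    + have [L [eL hL]] := parallel_cover J HJ z0 y0 w
        (eq_trans (delta_sym y0 z0) (f_equal inv e0)) hnorm.
      exists L; split=> // f /hL [r [h [rL [fh ->]]]]; exists r, h; split=> //; split=> //.
      apply: (fixer_residue J HJ _ _ _ _ fh); exact: (res_sym J HJ).
  - move=> V k VC hk.
    have [k1 hk1] := compact_cover _ _ (aco a nil) VC.
    have [k2 hk2] := compact_cover _ _ VC (aco a nil).
    have [lA [ndA hlA]] := residue_finite HF J a HJ.
    apply: (pow_le_bound _ (k1 * k2 * length lA)) => n.
    have Gn := G_iter g n Gg.
    (* Pass from the conjugate of U to that of [V] ([k1] cosets), down to [V] ([k ^ n]), then to U
       ([k2]): only the middle factor depends on [n]. *)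
    have cov : coset_cover (conjg (fixer J [a]) (Nat.iter n g)) (fixer J [a]) (k1 * k ^ n * k2).
    { apply: coset_cover_trans hk2; apply: coset_cover_trans; first exact: coset_cover_conj hk1.
      exact: (coset_cover_iter V g k n Gg (proj1 VC)). }
    have cov' : coset_cover (fixer J [Nat.iter n g a]) (fixer J [a]) (k1 * k ^ n * k2).
    { apply: coset_cover_sub cov => f; exact: (proj2 (fixer_conj J [a] _ f Gn)). }
    have [T [eT hT]] := cover_chambers J HJ _ a _ lA cov' hlA.
    have [z [hz ez]] := delta_pow_realized J a g w n HJ Gg hex hnorm' (fun i _ => hlen i) y0 hy0.
    have ez' : delta z y0 = inv (pow w n) by rewrite delta_sym ez.
    apply: (Nat.le_trans _ (N z (inv (pow w n)))).
    + rewrite (N_const z0 z); elim: n {Gn cov cov' T eT hT hz ez ez'} => [|n IH] /=.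
      * have : In z (sphere HF z (inv one)) by apply/sphereP; rewrite inv1 delta_refl.
        case: (sphere HF z (inv one)) => //= *; lia.
      * apply: (Nat.le_trans _ (N z (inv (pow w n)) * N z (inv w))).
        -- rewrite Nat.mul_comm; exact: Nat.mul_le_mono_r.
        -- rewrite invM; apply: N_mul.
           rewrite -invM !len_inv -[w ** pow w n]/(pow w (Datatypes.S n)) !hlen /=; lia.
    + have -> : k1 * k2 * length lA * k ^ n = k1 * k ^ n * k2 * length lA by lia.
      rewrite -eT; apply: NoDup_incl_length; first exact: sphere_NoDup.
      move=> y /sphereP ey; apply: (hT y y0 z z) => //; by rewrite ez'.
Qed.

(* Shrinks the type L until the residue of c is, up to g, carried onto itself by the projection to the
   residue of [g a]; the projection is encoded by the minimality of [delta c1 y] in its J-coset. *)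
Lemma projection_stable_residue J a g : spherical W mul one S J -> G g ->
  exists L c y w, (forall s, L s -> J s) /\ res J a c /\ res J (g a) y /\
    res L y (g c) /\ delta c y = w /\
    min_right J w /\ forall u, inW L u -> inW L (w ** u ** inv w).
Proof.
  move=> HJ Gg.
  (* Invariant: the projection to the residue of [g a] carries the [L]-residue of [c] into that of
     [g c]. The list [ls] contains [L] and its length is the induction measure. *)
  suff H : forall n L c ls, length ls <= n -> (forall t, L t -> In t ls) ->
    (forall s, L s -> J s) -> res J a c ->
    (forall c1 y, res L c c1 -> res J (g a) y -> min_right J (delta c1 y) -> res L (g c) y) ->
    exists L c y w, (forall s, L s -> J s) /\ res J a c /\ res J (g a) y /\
      res L y (g c) /\ delta c y = w /\
      min_right J w /\ forall u, inW L u -> inW L (w ** u ** inv w).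
  { apply: (H (length S) J a S) => //; [exact: J_S | exact: res_refl]. }
  elim/lt_wf_ind => n IH L c ls hn hls LJ hc stab.
  have HL : spherical W mul one S L.
  { case: (HJ) => JS [l hl]; split; first by move=> s /LJ /JS.
    exists l => w hw; apply: hl; exact: inW_sub hw. }
  have JS := J_S J HJ; have LS := J_S L HL.
  have resLJ : forall x y, res L x y -> res J x y by move=> x y; exact: inW_sub.
  have gate : forall x, exists y, res J (g a) y /\ min_right J (delta x y).
  { move=> x; have [v [hv hm]] := min_right_exists J (delta x (g a)).
    have [y [e1 e2]] := delta_end x (g a) v.
    exists y; by rewrite /residue e1 e2. }
  have gate_eq : forall x y y', res J (g a) y -> res J (g a) y' ->
    min_right J (delta x y) -> min_right J (delta x y') -> y = y'.
  { move=> x y y' hy hy'; apply: (gate_unique J HJ).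
    exact: (res_trans J HJ _ _ _ (res_sym J HJ _ _ hy)). }
  (* A closest pair between the two [L]-residues: its second chamber must be the projection of [c1],
     because a distance that is shortest modulo W_J is also shortest modulo W_L. *)
  have [c1 [y1 [hc1 [hy1 [hJ hD]]]]] : exists c1 y1, res L c c1 /\ res J (g a) y1 /\
    min_right J (delta c1 y1) /\ min_double L (delta c1 y1).
  { have [c1 [y0 [hc1 [hy0 hD]]]] := min_double_pair L c (g c) HL.
    have [y1 [hy1 hJ]] := gate c1.
    have y01 := res_trans L HL _ _ _ (res_sym L HL _ _ hy0) (stab c1 y1 hc1 hy1 hJ).
    exists c1, y1; split=> //; split=> //; split=> //.
    suff -> : y1 = y0 by [].
    symmetry; apply: (gate_unique L HL c1) => //; first exact: min_double_right.
    move=> v hv; apply: hJ; exact: inW_sub hv. }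
  set w := delta c1 y1 in hJ hD.
  have hy1L := stab c1 y1 hc1 hy1 hJ.
  have hc1a : res J a c1 := res_trans J HJ _ _ _ hc (resLJ _ _ hc1).
  (* The type of the image of the projection. If it is smaller than [L], the argument restarts at
     g^-1 of this image. *)
  pose L1 t := L t /\ L (w ** t ** inv w).
  case: (classic (forall t, L t -> L1 t)) => [all | nall].
  { exists L, c1, y1, w; split=> //; split=> //; split=> //; split.
    - apply: (res_trans L HL _ (g c)); first exact: (res_sym L HL).
      exact/res_G.
    - split=> //; split=> //; apply: conj_parabolic => s /all []. done. }
  have [t0 [Lt0 nt0]] : exists t, L t /\ ~ L1 t.
  { apply: NNPP => h; apply: nall => t Lt; apply: NNPP => nt; apply: h; by exists t. }
  have [g' [Gg' [g'g gg']]] := G_inv g Gg.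
  have L1L : forall t, L1 t -> L t by move=> t [].
  have hc2 : res L c (g' y1) by apply/(res_G L g) => //; rewrite gg'.
  have decW : forall x y : W, {x = y} + {x <> y} by move=> x y; exact: excluded_middle_informative.
  apply: (IH (length (remove decW t0 ls)) _ L1 (g' y1) (remove decW t0 ls)) => //.
  - apply: Nat.lt_le_trans hn; apply: remove_length_lt; exact: hls.
  - move=> t ht; apply: in_in_remove; last by apply: hls; exact: L1L.
    move=> e; apply: nt0; by rewrite -e.
  - by move=> s /L1L /LJ.
  - by apply/(res_G J g) => //; rewrite gg'.
  - rewrite gg' => c3 y hc3 hy hm.
    have hc3L : res L c1 c3.
    { apply: (res_trans L HL _ c); first exact: res_sym.
      apply: (res_trans L HL _ _ _ hc2); exact: inW_sub hc3. }
    have [l [hl el]] := hc3L.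
    have gal := gallery_of_delta c1 c3 l (Forall_impl _ LS hl) (eq_sym el).
    have hL1 : spherical W mul one S L1.
    { split; first by move=> s /L1L /LS.
      case: HL => _ [l' hl']; exists l' => v hv; apply: hl'; exact: inW_sub hv. }
    clear hc3 hc3L el.
    elim/rev_ind: l c3 y hl gal hy hm => [|s l IHl] c3 y hl.
    + move=> /= <- hy hm; rewrite (gate_eq c1 y y1) //; exact: res_refl.
    + move=> /gallery_app [c4 [gal4 /= [z [e4 ez]]]] hy hm; subst z.
      move/Forall_app: hl => [hl /(Forall_inv (P := L)) hs].
      have [y4 [hy4 hm4]] := gate c4.
      have h4 := IHl c4 y4 hl gal4 hy4 hm4.
      have hsS := LS s hs.
      have e34 : delta c3 c4 = s by exact: delta_symS.
      have h14 := gallery_res L HL c1 l c4 hl gal4.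
      have h13 : res L c1 c3.
      { by apply: (res_trans L HL _ _ _ h14); rewrite /residue e4; exact: inW_gen. }
      set p := delta c4 y4 in hm4.
      (* Along a gallery in the [L]-residue, a step either keeps the projection or, by [deodhar],
         moves it across a panel of some type [t]; it remains to see that [t] is in [L1]. *)
      have [stay | cross] : min_right J (delta c3 y4) \/
          delta c3 y4 = s ** p /\ ~ min_right J (s ** p).
      { have : delta c3 y4 = s ** p \/ delta c3 y4 = p.
        { rewrite /p (delta_sym y4 c3) (delta_sym y4 c4).
          case: (delta_step y4 c4 c3 s hsS e4) => ->; last by right.
          by left; rewrite invM (invS s). }
        case=> ->; last by left.
        by case: (classic (min_right J (s ** p))) => h; [left | right]. }
      { by rewrite (gate_eq c3 y y4). }
      move: cross => [e5 /(deodhar J JS _ _ hm4 hsS) [t [Jt et]]].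
      have [y5 [e6 e7]] := delta_end c3 y4 t.
      have ep : delta c3 y5 = p by rewrite e7 e5 et mulSK //; exact: JS.
      have ey : y = y5.
      { apply: (gate_eq c3) => //; last by rewrite ep.
        apply: (res_trans J HJ _ y4) => //; rewrite /residue e6; exact: inW_gen. }
      subst y5.
      have Lt : L t.
      { apply: (parabolic_len1 L LS); last exact/len_S/JS.
        rewrite -e6; apply: (res_trans L HL _ (g c)).
        - apply: (res_sym L HL); apply: stab hy4 hm4; exact: (res_trans L HL _ c1).
        - apply: stab hy hm; exact: (res_trans L HL _ c1). }
      apply: (res_trans L1 hL1 _ y4) => //; rewrite /residue e6; apply: inW_gen; split=> //.
      have [u [v [hu [hv epw]]]] := delta_double_coset L HL c1 y1 c4 y4 h14
        (inW_sub _ _ _ L1L h4).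
      have hpL : min_right L (u ** w ** v).
      { rewrite -epw => v' hv'; apply: hm4; exact: inW_sub hv'. }
      have [u' [hu' epu]] := min_right_in_double L LS w u v hD hu hv hpL.
      have er : w ** t ** inv w = inv u' ** s ** u'.
      { apply: (mulIr _ _ w); rewrite mulVK; apply: (mulI _ _ u').
        have -> : u' ** (w ** t) = p ** t by rewrite mulA -epu -epw.
        by rewrite -et /p epw epu !mulA mulwV mul1w. }
      have hr : inW L (inv u' ** s ** u').
      { apply: inW_mul => //; apply: inW_mul; [exact: inW_inv | exact: inW_gen]. }
      rewrite er; apply: (parabolic_len1 L LS _ hr).
      (* Both [w ** t] and the inverse of [r ** w], for the conjugate r = w t w^-1, have additive
         lengths; hence r has length 1 and is a generator in [L]. *)
      have h1 := min_right_len L LS w t (min_double_right L w hD) (inW_gen L t Lt).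
      have h2 := min_right_len L LS (inv w) _ (min_double_right L _ (min_double_inv L LS w hD))
        (inW_inv L _ LS hr).
      rewrite -invM !len_inv -er mulVK h1 (len_S t) in h2; last exact: JS.
      rewrite -er; lia.
Qed.

(** * A tidy stabilizer has straight displacement *)

Lemma tidy_normalises J a g w : spherical W mul one S J -> G g -> tidy C G (fixer J [a]) g ->
  (exists y z, res J a y /\ res J (g a) z /\ delta y z = w) -> min_double J w ->
  (forall s, J s -> J (w ** s ** inv w)) /\ (forall s, J s -> J (inv w ** s ** w)).
Proof.
  move=> HJ Gg td [y0 [z0 [hy0 [hz0 e0]]]] hw.
  have JS := J_S J HJ.
  have [_ [d [hd least]]] := proj1 (tidy_cover _ g Gg) td.
  have [L [c [y1 [w' [LJ [hc [hy1 [hyL [e1 [hw' norm]]]]]]]]]] := projection_stable_residue J a g HJ Gg.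
  have HL : spherical W mul one S L.
  { case: (HJ) => _ [l hl]; split; first by move=> s /LJ /JS.
    exists l => v hv; apply: hl; exact: inW_sub hv. }
  have le_d : d <= N y1 (inv w').
  { apply: (least (fixer L [c])); first exact: fixer_compact_open.
    apply: (coset_cover_sub (fixer L [y1])).
    - move=> f /(fixer_conj L [c] g f Gg); apply: fixer_residue => //; exact: (res_sym L HL).
    - by apply: (parallel_cover L HL) => //; rewrite delta_sym e1. }
  have [lA [ndA hlA]] := residue_finite HF J a HJ.
  have hd' : coset_cover (fixer J [g a]) (fixer J [a]) d.
  { apply: coset_cover_sub hd => f; exact: (proj2 (fixer_conj J [a] g f Gg)). }
  have [T [eT hT]] := cover_chambers J HJ _ _ _ lA hd' hlA.
  (* Chambers whose projection to the residue of [g a] is at distance [inv w']. Uniqueness of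
     projections makes the list duplicate-free; it lies inside [T] and, by [le_d], is at least as
     long, so nothing else is in [T]. *)
  pose T' := flat_map (fun z => sphere HF z (inv w')) (map g lA).
  have hgA : forall z, In z (map g lA) -> res J (g a) z.
  { by move=> z /in_map_iff [x [<- /hlA h]]; apply/res_G. }
  have ndT' : NoDup T'.
  { apply: NoDup_flat_map.
    - apply: NoDup_map_NoDup_ForallPairs => // x x' _ _; exact: G_inj.
    - move=> z _; exact: sphere_NoDup.
    - move=> z z' y /hgA hz /hgA hz' /sphereP e /sphereP e'.
      apply: (gate_unique J HJ y).
      + exact: (res_trans J HJ _ _ _ (res_sym J HJ _ _ hz)).
      + by rewrite delta_sym e invK.
      + by rewrite delta_sym e' invK. }
  have incT : incl T T'.
  { apply: NoDup_length_incl => //.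
    - rewrite eT (length_flat_map_const _ _ _ _ (N y1 (inv w'))).
      + by rewrite length_map Nat.mul_comm; apply: Nat.mul_le_mono_l.
      + move=> z _; exact: N_const.
    - move=> y /in_flat_map [z [/hgA hz /sphereP e]].
      apply: (hT y c y1 z) => //; by rewrite e delta_sym e1. }
  (* Every chamber realizing [u ** w] lies in [T], hence in [T']: the double coset of [w] is the
     single coset of [w']. *)
  have single : forall u, inW J u -> exists v, inW J v /\ u ** w = w' ** v.
  { move=> u hu.
    have [y [z [hy [hz e]]]] := double_coset_realized J HJ y0 z0 u one hu (inW_one J).
    have {}hy := res_trans J HJ _ _ _ hy0 hy; have {}hz := res_trans J HJ _ _ _ hz0 hz.
    have /incT /in_flat_map [z' [/hgA hz' /sphereP e']] : In y T by apply: (hT y y z z).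
    have [v [hv ev]] := delta_right J y z' z JS (res_trans J HJ _ _ _ (res_sym J HJ _ _ hz') hz).
    exists v; split=> //.
    by rewrite -(mulw1 (u ** w)) -e0 -e ev delta_sym e' invK. }
  have [v0 [hv0 ev0]] := single one (inW_one J); rewrite mul1w in ev0.
  have conjV : forall s, J s -> J (inv w ** s ** w).
  { move=> s Js; have sS := JS s Js.
    have [v [hv ev]] := single s (inW_gen J s Js).
    have e : s ** w = w ** (inv v0 ** v) by rewrite ev {1}ev0 !mulA mulK.
    have hr : inW J (inv v0 ** v) by apply: inW_mul => //; exact: inW_inv.
    have -> : inv w ** s ** w = inv v0 ** v.
    { by rewrite -mulA e mulA mulVw mul1w. }
    apply: (parabolic_len1 J JS _ hr).
    have h1 := min_right_len J JS w _ (min_double_right J w hw) hr.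
    have h2 := min_right_len J JS (inv w) s (min_double_right J _ (min_double_inv J JS w hw)) (inW_gen J s Js).
    have h3 : inv w ** s = inv (s ** w) by rewrite invM (invS s).
    rewrite h3 !len_inv (len_S s sS) e h1 in h2; lia. }
  split=> // t Jt.
  (* Conjugation maps the finite set [J] injectively into itself, hence onto itself, which yields
     the other inclusion. *)
  have [s [Js <-]] := finite_injective_surjective W J S (fun s => inv w ** s ** w) JS conjV
    (fun x y _ _ e => mulI _ _ _ (mulIr _ _ _ e)) t Jt.
  by rewrite !mulA mulwV mul1w mulK.
Qed.

(** Multiplying by a generator changes the length by going strictly up or strictly down, so a loss
    in the total length reveals a prefix followed by a descent. *)
Lemma length_drop v l : Forall isS l -> len (v ** prod l) < len v + length l ->
  exists l1 s l2, l = l1 ++ s :: l2 /\ len (v ** prod l1 ** s) < len (v ** prod l1).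
Proof.
  elim: l v => [|s l IH] v hl /=; first by rewrite mulw1; lia.
  inversion hl as [|? ? hs hl']; subst => lt.
  have up_or_down : len v < len (v ** s) \/ len (v ** s) < len v.
  { have [m [hm [em ev]]] := reduced_word v.
    case: (exchange m s hm hs); rewrite ev; first by left.
    move=> [m1 [t [m2 [e1 e2]]]]; right; rewrite e2.
    have hm' : Forall isS (m1 ++ m2).
    { move: hm; rewrite e1 => /Forall_app [h1 h2]; inversion h2; exact/Forall_app. }
    have := len_prod _ hm'; move: em; rewrite e1 !length_app /=; lia. }
  case: up_or_down => h.
  - have [||l1 [t [l2 [-> lt']]]] := IH (v ** s) => //; first by rewrite -mulA; lia.
    by exists (s :: l1), t, l2; rewrite /= mulA.
  - by exists nil, s, l; rewrite /= mulw1.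
Qed.

Section ThickBuilding.
Hypothesis HTh : thick W S C delta.

Lemma tidy_pow_length J a g w : spherical W mul one S J -> G g -> tidy C G (fixer J [a]) g ->
  (exists y z, res J a y /\ res J (g a) z /\ delta y z = w) -> min_double J w ->
  forall n, len (pow w n) = n * len w.
Proof.
  move=> HJ Gg td hex hw.
  have JS := J_S J HJ.
  have [norm norm'] := tidy_normalises J a g w HJ Gg td hex hw.
  have hnorm := conj_parabolic J w norm.
  have hnorm' : forall u, inW J u -> inW J (inv w ** u ** w).
  { move=> u hu; rewrite -{2}(invK w); apply: conj_parabolic hu => t ht; rewrite invK; exact: norm'. }
  have [aco [d [hd least]]] := proj1 (tidy_cover _ g Gg) td.
  suff H : forall m i, i <= m -> len (pow w i) = i * len w by move=> n; exact: (H n n).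
  elim=> [|m IH] i.
  { move=> h; have -> : i = 0 by lia. by rewrite /= len_one. }
  move=> le; case: (le_lt_dec i m) => [|lt]; first exact: IH.
  have {le lt}-> : i = Datatypes.S m by lia.
  pose X := map (fun i => Nat.iter i g a) (seq 0 (Datatypes.S m)).
  have inX : forall i, i <= m -> In (Nat.iter i g a) X.
  { move=> j hj; apply/in_map_iff; exists j; split=> //; apply/in_seq; lia. }
  have trans : forall f, fixer J [g a] f -> exists h u, fixer J (map g X) h /\ fixer J [a] u /\
    f = (fun x => h (u x)).
  { apply: (transitive_of_index _ (fixer J [g a]) _ d).
    - exact: fixer_subgroup.
    - exact: fixer_subgroup.
    - move=> f [Gf hf]; apply/fixer1; split=> //; apply: hf; apply: (in_map g X a).
      exact: (inX 0 (Nat.le_0_l m)).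
    - apply: coset_cover_sub hd => f; exact: (proj2 (fixer_conj J [a] g f Gg)).
    - move=> k [M [eM hM]].
      apply: (least (fixer J X)); first exact: fixer_compact_open.
      exists M; split=> // f /(fixer_conj J X g f Gg) /hM [r [h [rM [[[Gh h1] /fixer1 [_ h2]] ->]]]].
      exists r, h; split=> //; split=> //; split=> // x /in_map_iff [j [<- /in_seq hj]].
      case: j hj => [|j] hj //.
      apply: (h1 (Nat.iter (Datatypes.S j) g a)); apply: (in_map g X (Nat.iter j g a)).
      apply: inX; lia. }
  have [zz [hzz ezz]] := delta_pow_realized J a g w m HJ Gg hex hnorm' IH a (res_refl J a).
  pose y := g a; pose z := g zz; pose v := inv (pow w m).
  have ezy : delta z y = v by rewrite delta_sym G_delta // ezz.
  have hz : res J (Nat.iter (Datatypes.S m) g a) z by apply/(res_G J g).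
  have [x0 [hx0 ex0]] : exists x0, res J a x0 /\ delta y x0 = inv w.
  { have [y0 [z0 [hy0 [hz0 e0]]]] := hex.
    have [u [hu eu]] := delta_right J y0 z0 y JS (res_sym J HJ _ _ hz0).
    have [x0 [e1 e2]] := delta_start y0 y (inv (w ** u ** inv w)).
    exists x0; split.
    - apply: (res_trans J HJ _ _ _ hy0); apply: (res_sym J HJ); rewrite /residue e1.
      apply: inW_inv => //; exact: hnorm.
    - by rewrite delta_sym e2 eu e0; congr inv; rewrite !invM invK !mulA !mulVK. }
  (* Write [f = h u]. The inverse of [h] keeps [z] in its residue and takes [q = h (u x0)] to a
     chamber of the residue of [a]; comparing two such [q] puts their distances from [z] in one
     double coset. *)
  have relative : forall q, delta y q = inv w ->
    exists b c, res J (Nat.iter (Datatypes.S m) g a) b /\ res J a c /\ delta z q = delta b c.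
  { move=> q eq.
    have [f [Gf [fy fx]]] := HT y x0 y q (eq_trans ex0 (eq_sym eq)).
    have [h [u [fh [/fixer1 [Gu hu] ef]]]] : exists h u, fixer J (map g X) h /\ fixer J [a] u /\
      f = (fun x => h (u x)).
    { apply: trans; apply/fixer1; split=> //; rewrite -/y fy; exact: res_refl. }
    have [_ [_ [_ hV]]] := fixer_subgroup J HJ (map g X).
    have [h' [[Gh' fh'] eh']] := hV h fh.
    exists (h' z), (u x0); split; [|split].
    - apply: (res_trans J HJ _ (h' (Nat.iter (Datatypes.S m) g a))); last by apply/res_G.
      apply: fh'; apply: (in_map g X (Nat.iter m g a)); exact: inX.
    - by apply: (res_trans J HJ _ _ _ hu); apply/res_G.
    - rewrite -fx ef -{1}(proj2 (eh' z)) G_delta //; by case: fh. }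
  have upper := len_mul w (pow w m).
  rewrite (IH m (le_n m)) in upper.
  case: (le_lt_dec (Datatypes.S m * len w) (len (pow w (Datatypes.S m)))) => [|drop].
  { rewrite /=; lia. }
  have [l [hl [el ewl]]] := reduced_word (inv w).
  have [|l1 [s [l2 [esplit lt]]]] := length_drop v l hl.
  { rewrite ewl el /v -invM !len_inv (IH m (le_n m)) -/(pow w (Datatypes.S m)).
    move: drop; rewrite /=; lia. }
  move: (hl); rewrite esplit => /Forall_app [hl1 hl']; inversion hl' as [|? ? hs hl2]; subst.
  have [q [eq gq]] := gallery_forth z y (l1 ++ s :: l2) hl.
  have eyq : delta y q = inv w by rewrite -ewl; apply: gallery_reduced; rewrite // ewl.
  have [q1 [eq1 gq1]] := gallery_forth z y l1 hl1.
  (* At the descent [s] the gallery still crosses a panel but its distance from [z] stands still: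
     [q3] is as far from [y] as [q], while its distance from [z] omits the letter [s]. *)
  have [q2 [e12 eq2]] : exists q2, delta q1 q2 = s /\ delta z q2 = delta z q1.
  { by apply: delta_fold; rewrite // eq1 ezy. }
  have [q3 [eq3 gq3]] := gallery_forth z q2 l2 hl2.
  have eyq3 : delta y q3 = inv w.
  { rewrite -ewl; apply: gallery_reduced; rewrite // ?ewl //.
    apply/gallery_app; exists q1; split=> //; by exists q2. }
  have [b [c [hb [hc ebc]]]] := relative q eyq.
  have [b3 [c3 [hb3 [hc3 ebc3]]]] := relative q3 eyq3.
  have [u1 [u2 [hu1 [hu2 e3]]]] := delta_double_coset J HJ b c b3 c3
    (res_trans J HJ _ _ _ (res_sym J HJ _ _ hb) hb3) (res_trans J HJ _ _ _ (res_sym J HJ _ _ hc) hc3).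
  pose P := pow w (Datatypes.S m).
  have eP : v ** inv w = inv P by rewrite /P /= invM.
  have hP : inW J (P ** u1 ** inv P) by exact: conj_pow_parabolic.
  clearbody P.
  (* Since powers of [w] normalise W_J, the left factor [u1] can be pushed through to the right,
     which puts the word without [s] in w^-1 W_J, although it is shorter than [w]. *)
  have e : prod (l1 ++ l2) = inv w ** ((P ** u1 ** inv P) ** u2).
  { apply: (mulI _ _ v); rewrite (mulA v (inv w)) eP.
    have -> : v ** prod (l1 ++ l2) = u1 ** inv P ** u2.
    { by rewrite prod_app mulA -ezy -eq1 -eq2 -eq3 ebc3 e3 -ebc eq ewl ezy eP. }
    by rewrite !mulA mulVw mul1w. }
  have := min_double_right J _ (min_double_inv J JS w hw) ((P ** u1 ** inv P) ** u2).
  rewrite -e => bound.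
  have hl12 : Forall isS (l1 ++ l2) by apply/Forall_app.
  have := len_prod _ hl12; move: el; rewrite !length_app /= => el short.
  have : inW J ((P ** u1 ** inv P) ** u2); last by move=> /bound; lia.
  exact: inW_mul.
Qed.


Lemma tidy_iff_straight J a g : spherical W mul one S J -> G g ->
  (tidy C G (stabilizer C G (res J a)) g <->
   exists w, res_dist W mul one S C delta (res J a) (image_res C g (res J a)) w /\
     straight W mul one inv S J w).
Proof.
  move=> HJ Gg.
  have -> : stabilizer C G (res J a) = fixer J [a].
  { apply: functional_extensionality => f; apply: propositional_extensionality.
    exact: stabilizer_fixer. }
  split.
  - move=> td.
    have [y [z [hy [hz hw]]]] := min_double_pair J a (g a) HJ.
    have hex : exists y' z', res J a y' /\ res J (g a) z' /\ delta y' z' = delta y z.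
    { by exists y, z. }
    have [norm norm'] := tidy_normalises J a g _ HJ Gg td hex hw.
    have hlen := tidy_pow_length J a g _ HJ Gg td hex hw.
    exists (delta y z); split; first by apply/res_dist_min_double.
    split; first by move=> u v hu hv n m /has_lengthE -> /has_lengthE ->; exact: hw.
    split=> //; split.
    + move=> t /norm' Jt; exists (inv (delta y z) ** t ** delta y z); split=> //.
      by rewrite !mulA mulwV mul1w mulK.
    + by move=> k n /has_lengthE ->; apply/has_lengthE; rewrite hlen.
  - move=> [w [/res_dist_min_double h st]]; have [hex _] := h HJ Gg.
    exact: straight_tidy hex st.
Qed.

End ThickBuilding.
End Residues.
End Group.
End Building.
End Coxeter.

Theorem theorem5p5
  (W : Type) (mul : W -> W -> W) (one : W) (inv : W -> W) (S : list W)
  (C : Type) (delta : C -> C -> W) (G : (C -> C) -> Prop) :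
  is_coxeter_system W mul one inv S ->
  is_building W mul one S C delta ->
  thick W S C delta ->
  locally_finite W S C delta ->
  aut_group W C delta G ->
  closed_group W C delta G ->
  weyl_transitive W C delta G ->
  forall g : C -> C, G g ->
  forall (J : W -> Prop) (a : C),
    spherical W mul one S J ->
    (tidy C G (stabilizer C G (residue W mul one C delta J a)) g <->
     exists w,
       res_dist W mul one S C delta
         (residue W mul one C delta J a)
         (image_res C g (residue W mul one C delta J a)) w /\
       straight W mul one inv S J w).
Proof.
  move=> HC HD HTh HF HG HCl HT g Gg J a HJ.
  exact: (tidy_iff_straight W mul one inv S HC C delta HD G HG HF HCl HT HTh J a g HJ Gg).
Qed.
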